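(* Let $\mathbb{K}$ be a field of characteristic $0$. There are no nilpotent quadratic Lie algebras over $\mathbb{K}$ of type $2$ and nilpotent index $2$ or $4$. In addition, up to metric (isometric) isomorphism: (i) The nilpotent quadratic Lie algebras of type $2$ and nilpotent index $3$ are those of the form $(\mathfrak{n}_{2,3},B_{2,3}^{0;\gamma})$ for any $0\neq\gamma\in\mathbb{K}$. Moreover, $(\mathfrak{n}_{2,3},B_{2,3}^{0;\gamma})$ and $(\mathfrak{n}_{2,3},B_{2,3}^{0;\delta})$ are isometrically isomorphic if and only if $\delta$ and $\gamma$ are congruent modulo $(\mathbb{K}^* )^2$ (i.e. $\delta/\gamma\in(\mathbb{K}^* )^2$). (ii) The nilpotent quadratic Lie algebras of type $2$ and nilpotent index $5$ are those of the form $\left(\mathfrak{n}_{2,5}/\mathrm{Ker}\,B_{2,5}^{0;0;A},\ \overline{B_{2,5}^{0;0;A}}\right)$ for an arbitrary $2\times2$ nonzero symmetric matrix $A$. Moreover, the algebras obtained from $A$ and from $B$ (nonzero symmetric) are isometrically isomorphic if and only if $B=(\det P)^2P^tAP$ for some regular $2\times2$ matrix $P$. All the quadratic algebras described in (i) and (ii) are indecomposable. In (i) the number of pairwise non-isometrically-isomorphic algebras is the cardinal of the group $\mathbb{K}^*/(\mathbb{K}^* )^2$. In (ii), if for every $\alpha\in\mathbb{K}$ there exists $\delta\in\mathbb{K}$ with $\delta^3=\alpha$, then the algebras obtained from $A$ and $B$ are isomorphic as metric Lie algebras if and only if $A$ and $B$ are congruent.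
   Context: For a Lie algebra $\mathfrak{n}$ put $\mathfrak{n}^1=\mathfrak{n}$, $\mathfrak{n}^i=[\mathfrak{n}^{i-1},\mathfrak{n}]$. A nilpotent $\mathfrak{n}$ has nilpotent index $t$ if $\mathfrak{n}^{t+1}=0$, $\mathfrak{n}^t\ne0$; its type is $\dim\mathfrak{n}/\mathfrak{n}^2$. A quadratic Lie algebra is a pair $(\mathfrak{n},B)$ with $B$ a nondegenerate symmetric bilinear form that is invariant: $B([x,y],z)=B(x,[y,z])$. Isometric (metric) isomorphisms are Lie algebra isomorphisms preserving the forms. A quadratic Lie algebra is decomposable if it contains a proper nonzero ideal on which the form restricts to a nondegenerate form; otherwise indecomposable. Matrices $A,B$ are congruent if $B=P^tAP$ with $P$ invertible. $\mathbb{K}^*=\mathbb{K}\setminus\{0\}$, $(\mathbb{K}^* )^2=\{k^2:k\in\mathbb{K}^*\}$. $\mathrm{Ker}(B)=\{x : B(x,y)=0\ \forall y\}$, which is an ideal for invariant symmetric $B$, and $\overline{B}$ is the induced nondegenerate form on the quotient by $\mathrm{Ker}(B)$. $\mathfrak{n}_{2,t}$ is the free $t$-nilpotent Lie algebra over $\mathbb{K}$ on generators $x_1,x_2$ (free Lie algebra modulo the $(t+1)$-st term of its lower central series). Put $h_1=x_1$, $h_2=x_2$, $h_3=[x_2,x_1]$, $h_4=[h_3,x_1]$, $h_5=[h_3,x_2]$, $h_6=[h_4,x_1]$, $h_7=[h_4,x_2]$, $h_8=[h_5,x_2]$, $h_9=[h_6,x_1]$, $h_{10}=[h_6,x_2]$,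 $h_{11}=[h_4,h_3]$, $h_{12}=[h_7,x_2]$, $h_{13}=[h_5,h_3]$, $h_{14}=[h_8,x_2]$. Then $(h_1,\dots,h_5)$ is a basis of $\mathfrak{n}_{2,3}$ and $(h_1,\dots,h_{14})$ one of $\mathfrak{n}_{2,5}$. $B=B_{2,3}^{0;\gamma}$ is the invariant symmetric bilinear form on $\mathfrak{n}_{2,3}$ with $B(h_1,h_5)=\gamma$, $B(h_2,h_4)=-\gamma$, $B(h_3,h_3)=\gamma$ and all other values on pairs of basis vectors (up to symmetry) $0$. For $A=\begin{pmatrix}d&e\\ e&f\end{pmatrix}$, $B=B_{2,5}^{0;0;A}$ is the invariant symmetric bilinear form on $\mathfrak{n}_{2,5}$ with $B(h_4,h_4)=d$, $B(h_4,h_5)=e$, $B(h_5,h_5)=f$; $B(h_3,h_6)=-d$, $B(h_3,h_7)=-e$, $B(h_3,h_8)=-f$; $(B(h_1,h_j))_{j=9}^{14}=(0,-d,d,-e,e,-f)$; $(B(h_2,h_j))_{j=9}^{14}=(d,0,e,0,f,0)$; all other values on pairs of basis vectors (up to symmetry) $0$. *)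

(* Defs.v *)
From HB Require Import structures.
From mathcomp Require Import all_boot all_order all_algebra.
From mathcomp Require Import generic_quotient ring_quotient sesquilinear.
From mathcomp Require Import boolp classical_sets functions cardinality.
From mathcomp Require Import ring.

Set Implicit Arguments.
Unset Strict Implicit.
Unset Printing Implicit Defensive.

Import GRing.Theory.
Local Open Scope ring_scope.
Local Open Scope quotient_scope.

HB.mixin Record Lmodule_isLie (K : fieldType) L of GRing.Lmodule K L := {
  lbr : L -> L -> L;
  lbr_linearl : forall z, linear (fun x => lbr x z);
  lbr_linearr : forall z, linear (lbr z);
  lbrxx : forall x, lbr x x = 0;
  lbr_jacobi : forall x y z,
    lbr (lbr x y) z + lbr (lbr y z) x + lbr (lbr z x) y = 0
}.

(* No dimension hypothesis: a nilpotent Lie algebra of finite type is         *)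
(* automatically finite-dimensional.                                         *)
#[short(type="lieAlgType")]
HB.structure Definition LieAlg (K : fieldType) :=
  {L of GRing.Lmodule K L & Lmodule_isLie K L}.

Section LieTheory.
Variables (K : fieldType) (L : lieAlgType K).
Implicit Types x y z : L.

Lemma lbrDl x y z : lbr (x + y) z = lbr x z + lbr y z.
Proof. by have := lbr_linearl z 1 x y; rewrite /= !scale1r. Qed.

Lemma lbrDr x y z : lbr z (x + y) = lbr z x + lbr z y.
Proof. by have := lbr_linearr z 1 x y; rewrite /= !scale1r. Qed.

Lemma lbr0l z : lbr 0 z = 0.
Proof. by apply: (addrI (lbr 0 z)); rewrite -lbrDl !addr0. Qed.

Lemma lbr0r z : lbr z 0 = 0.
Proof. by apply: (addrI (lbr z 0)); rewrite -lbrDr !addr0. Qed.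

Lemma lbrZl a x z : lbr (a *: x) z = a *: lbr x z.
Proof. by have := lbr_linearl z a x 0; rewrite /= !addr0 lbr0l addr0. Qed.

Lemma lbrZr a x z : lbr z (a *: x) = a *: lbr z x.
Proof. by have := lbr_linearr z a x 0; rewrite /= !addr0 lbr0r addr0. Qed.

Lemma lbrNl x z : lbr (- x) z = - lbr x z.
Proof. by rewrite -scaleN1r lbrZl scaleN1r. Qed.

Lemma lbrNr x z : lbr z (- x) = - lbr z x.
Proof. by rewrite -scaleN1r lbrZr scaleN1r. Qed.

Lemma lbrC x y : lbr x y = - lbr y x.
Proof.
apply/eqP; rewrite -addr_eq0; have := lbrxx (x + y).
by rewrite lbrDl !lbrDr !lbrxx add0r addr0 => ->.
Qed.

End LieTheory.

HB.mixin Record isLieIdealClosed (K : fieldType) (L : lieAlgType K)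
    (I : L -> bool) := {
  ideal_scale : forall (a : K) x, I x -> I (a *: x);
  ideal_lbrl : forall x y, I x -> I (lbr x y)
}.

#[short(type="lieIdeal")]
HB.structure Definition LieIdeal (K : fieldType) (L : lieAlgType K) :=
  {I of GRing.ZmodClosed L I & isLieIdealClosed K L I}.

Definition lieQuot (K : fieldType) (L : lieAlgType K) (I : lieIdeal L) : Type :=
  {ideal_quot I}.

Section LieQuotient.
Variables (K : fieldType) (L : lieAlgType K) (I : lieIdeal L).
Local Notation Q := (lieQuot I).

HB.instance Definition _ := GRing.Zmodule.on Q.
HB.instance Definition _ := Quotient.on Q.

Definition quot_pi (x : L) : Q := \pi_({ideal_quot I}) x.
Definition quot_repr (u : Q) : L := repr (u : {ideal_quot I}).

Lemma quot_reprK u : quot_pi (quot_repr u) = u.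
Proof. exact: reprK. Qed.

Lemma quot_piP x y : quot_pi x = quot_pi y <-> x - y \in I.
Proof.
rewrite Quotient.idealrBE; split; first by move=> /eqP.
by move=> /eqP.
Qed.

Lemma quot_pi_repr x : quot_repr (quot_pi x) - x \in I.
Proof. by apply/quot_piP; rewrite quot_reprK. Qed.

Lemma quot_piD x y : quot_pi (x + y) = quot_pi x + quot_pi y.
Proof. exact: raddfD. Qed.

Lemma quot_pi0 : quot_pi 0 = 0.
Proof. exact: raddf0. Qed.

Definition quot_scale (a : K) (u : Q) : Q := quot_pi (a *: quot_repr u).
Definition quot_lbr (u v : Q) : Q := quot_pi (lbr (quot_repr u) (quot_repr v)).

Lemma quot_scaleE a x : quot_scale a (quot_pi x) = quot_pi (a *: x).
Proof. by apply/quot_piP; rewrite -scalerBr; apply: ideal_scale; apply: quot_pi_repr. Qed.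

Lemma ideal_lbrr x y : y \in I -> lbr x y \in I.
Proof. by move=> Iy; rewrite lbrC rpredN; apply: ideal_lbrl. Qed.

Lemma quot_lbrE x y : quot_lbr (quot_pi x) (quot_pi y) = quot_pi (lbr x y).
Proof.
apply/quot_piP; set x' := quot_repr _; set y' := quot_repr _.
have -> : lbr x' y' - lbr x y = lbr (x' - x) y' + lbr x (y' - y).
  by rewrite lbrDl lbrDr lbrNl lbrNr addrA subrK.
by apply: rpredD; [apply: ideal_lbrl|apply: ideal_lbrr]; apply: quot_pi_repr.
Qed.

Lemma quot_scalerA a b v : quot_scale a (quot_scale b v) = quot_scale (a * b) v.
Proof. by rewrite -[v]quot_reprK !quot_scaleE scalerA. Qed.
Lemma quot_scale1r : left_id 1 quot_scale.
Proof. by move=> v; rewrite -[v]quot_reprK !quot_scaleE scale1r. Qed.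
Lemma quot_scalerDr : right_distributive quot_scale +%R.
Proof.
move=> a u v; rewrite -[u]quot_reprK -[v]quot_reprK -quot_piD !quot_scaleE.
by rewrite -quot_piD scalerDr.
Qed.
Lemma quot_scalerDl v : {morph quot_scale^~ v : a b / a + b}.
Proof.
by move=> a b; rewrite -[v]quot_reprK !quot_scaleE -quot_piD scalerDl.
Qed.

HB.instance Definition _ := GRing.Zmodule_isLmodule.Build K Q
  quot_scalerA quot_scale1r quot_scalerDr quot_scalerDl.

Lemma quot_piZ a x : quot_pi (a *: x) = a *: quot_pi x.
Proof. by rewrite -quot_scaleE. Qed.

Lemma quot_lbr_linearl z : linear (fun x => quot_lbr x z).
Proof.
move=> a x y; rewrite -[x]quot_reprK -[y]quot_reprK -[z]quot_reprK.
by rewrite -quot_piZ -quot_piD !quot_lbrE -quot_piZ -quot_piD lbrDl lbrZl.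
Qed.
Lemma quot_lbr_linearr z : linear (quot_lbr z).
Proof.
move=> a x y; rewrite -[x]quot_reprK -[y]quot_reprK -[z]quot_reprK.
by rewrite -quot_piZ -quot_piD !quot_lbrE -quot_piZ -quot_piD lbrDr lbrZr.
Qed.
Lemma quot_lbrxx x : quot_lbr x x = 0.
Proof. by rewrite -[x]quot_reprK quot_lbrE lbrxx quot_pi0. Qed.
Lemma quot_lbr_jacobi x y z :
  quot_lbr (quot_lbr x y) z + quot_lbr (quot_lbr y z) x
  + quot_lbr (quot_lbr z x) y = 0.
Proof.
rewrite -[x]quot_reprK -[y]quot_reprK -[z]quot_reprK !quot_lbrE -!quot_piD.
by rewrite lbr_jacobi quot_pi0.
Qed.

HB.instance Definition _ := Lmodule_isLie.Build K Q
  quot_lbr_linearl quot_lbr_linearr quot_lbrxx quot_lbr_jacobi.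

Lemma quot_pi_lbr x y : quot_pi (lbr x y) = lbr (quot_pi x) (quot_pi y).
Proof. by rewrite -quot_lbrE. Qed.

End LieQuotient.

Definition lie_morphism (K : fieldType) (L M : lieAlgType K) (f : L -> M) :=
  linear f /\ {morph f : x y / lbr x y}.

Section QuotientLift.
Variables (K : fieldType) (L M : lieAlgType K) (I : lieIdeal L) (f : L -> M).
Hypotheses (fP : lie_morphism f) (fI : forall x, x \in I -> f x = 0).

Definition quot_lift (u : lieQuot I) : M := f (quot_repr u).

Lemma quot_liftE x : quot_lift (quot_pi I x) = f x.
Proof.
have [fl _] := fP.
have := fl (-1) x (quot_repr (quot_pi I x)).
rewrite !scaleN1r [- x + _]addrC (fI (quot_pi_repr I x)) => /eqP.
by rewrite eq_sym addrC subr_eq0 => /eqP.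
Qed.

Lemma quot_lift_morphism : lie_morphism quot_lift.
Proof.
have [fl fb] := fP; split=> [a u v|u v];
  rewrite -[u]quot_reprK -[v]quot_reprK.
  by rewrite -quot_piZ -quot_piD !quot_liftE fl.
by rewrite -quot_pi_lbr !quot_liftE fb.
Qed.

End QuotientLift.

Section LowerCentralSeries.
Variables (K : fieldType) (L : lieAlgType K).

Definition lin_span (A : L -> Prop) : L -> bool := fun x =>
  `[< forall S : submodClosed L, (forall y, A y -> y \in S) -> x \in S >].

Lemma lin_spanP (A : L -> Prop) x :
  lin_span A x <->
  forall S : submodClosed L, (forall y, A y -> y \in S) -> x \in S.
Proof. by split=> /asboolP. Qed.

(* lcs i is n^i; the value at i = 0, which is not used, is the whole algebra. *)
Fixpoint lcs_rec (i : nat) : L -> bool :=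
  if i is j.+1
  then lin_span (fun z => exists x y, lcs_rec j x /\ z = lbr x y)
  else xpredT.

Definition lcs (i : nat) : {pred L} := lcs_rec i.-1.

Lemma lin_span0 A : lin_span A 0.
Proof. by apply/lin_spanP => S _; rewrite rpred0. Qed.
Lemma lin_spanD A x y : lin_span A x -> lin_span A y -> lin_span A (x + y).
Proof.
move=> /lin_spanP Ax /lin_spanP Ay; apply/lin_spanP => S AS.
by rewrite rpredD ?Ax ?Ay.
Qed.
Lemma lin_spanZ A a x : lin_span A x -> lin_span A (a *: x).
Proof. by move=> /lin_spanP Ax; apply/lin_spanP => S AS; rewrite rpredZ ?Ax. Qed.
Lemma mem_lin_span (A : L -> Prop) x : A x -> lin_span A x.
Proof. by move=> Ax; apply/lin_spanP => S; apply. Qed.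

Lemma lcs_rec_sub i x : lcs_rec i.+1 x -> lcs_rec i x.
Proof.
elim: i x => [//|i IH] x /= /lin_spanP H; apply/lin_spanP => S AS.
by apply: H => _ [y [z [yi ->]]]; apply: AS; exists y, z; split=> //; apply: IH.
Qed.

Lemma lcs0 i : lcs i 0.
Proof. by rewrite /lcs; case: i.-1 => //= j; apply: lin_span0. Qed.
Lemma lcsD i x y : lcs i x -> lcs i y -> lcs i (x + y).
Proof. by rewrite /lcs; case: i.-1 => //= j; apply: lin_spanD. Qed.
Lemma lcsZ i a x : lcs i x -> lcs i (a *: x).
Proof. by rewrite /lcs; case: i.-1 => //= j; apply: lin_spanZ. Qed.
Lemma lcs_lbr i x y : lcs i x -> lcs i (lbr x y).
Proof.
by move=> xi; apply: lcs_rec_sub; apply: mem_lin_span; exists x, y.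
Qed.

Lemma lcs_addr_closed i : addr_closed (lcs i).
Proof. by split=> [|x y]; [apply: lcs0|apply: lcsD]. Qed.
Lemma lcs_oppr_closed i : oppr_closed (lcs i).
Proof. by move=> x xi; rewrite -scaleN1r; apply: lcsZ. Qed.
Lemma lcs_scaler_closed i : GRing.scaler_closed (lcs i).
Proof. by move=> a x; apply: lcsZ. Qed.

HB.instance Definition _ i := GRing.isAddClosed.Build L (lcs i)
  (lcs_addr_closed i).
HB.instance Definition _ i := GRing.isOppClosed.Build L (lcs i)
  (@lcs_oppr_closed i).
HB.instance Definition _ i := isLieIdealClosed.Build K L (lcs i)
  (@lcs_scaler_closed i) (@lcs_lbr i).

Definition nil_index (t : nat) :=
  (forall x, x \in lcs t.+1 -> x = 0) /\ (exists2 x, x \in lcs t & x != 0).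

End LowerCentralSeries.

Arguments lcs {K} L i.

(* Vector.axiom d V: there is a linear bijection from V to 'rV_d.            *)
Definition has_type (K : fieldType) (L : lieAlgType K) (d : nat) :=
  inhabited (Vector.axiom d (lieQuot (lcs L 2 : lieIdeal L))).

HB.mixin Record isInvariantSym (K : fieldType) (L : lieAlgType K)
    (B : L -> L -> K) := {
  inv_sym : forall x y, B x y = B y x;
  inv_lbr : forall x y z, B (lbr x y) z = B x (lbr y z)
}.

#[short(type="invForm")]
HB.structure Definition InvForm (K : fieldType) (L : lieAlgType K) :=
  {B of @Bilinear K L L K *%R *%R B & isInvariantSym K L B}.

Section InvFormTheory.
Variables (K : fieldType) (L : lieAlgType K) (B : invForm L).

Lemma form0l z : B 0 z = 0.
Proof. exact: linear0l. Qed.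
Lemma formDl z x y : B (x + y) z = B x z + B y z.
Proof. exact: linearDl. Qed.
Lemma formNl z x : B (- x) z = - B x z.
Proof. exact: linearNl. Qed.
Lemma formBl z x y : B (x - y) z = B x z - B y z.
Proof. exact: linearBl. Qed.
Lemma formZl z a x : B (a *: x) z = a * B x z.
Proof. exact: linearZl_LR. Qed.
Lemma formDr z x y : B z (x + y) = B z x + B z y.
Proof. exact: linearDr. Qed.
Lemma formBr z x y : B z (x - y) = B z x - B z y.
Proof. exact: linearBr. Qed.
Lemma formZr z a x : B z (a *: x) = a * B z x.
Proof. exact: linearZr_LR. Qed.

End InvFormTheory.

Definition nondegenerate_form (K : fieldType) (L : lieAlgType K)
    (B : L -> L -> K) :=
  forall x, (forall y, B x y = 0) -> x = 0.

Record metricLie (K : fieldType) := MetricLie {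
  ml_alg :> lieAlgType K;
  ml_form : invForm ml_alg
}.
Arguments MetricLie {K ml_alg} ml_form.

Section Quadratic.
Variable K : fieldType.
Implicit Types M N : metricLie K.

Definition quadratic M := nondegenerate_form (ml_form M).

Definition nilp_quadratic (d t : nat) M :=
  [/\ quadratic M, has_type M d & nil_index M t].

Definition isometric M N := exists f : M -> N,
  [/\ lie_morphism f, bijective f
    & forall x y, ml_form N (f x) (f y) = ml_form M x y].

Definition decomposable M := exists I : lieIdeal M,
  [/\ exists2 x, x \in I & x != 0, exists x, x \notin I
    & forall x, x \in I -> (forall y, y \in I -> ml_form M x y = 0) -> x = 0].

Definition indecomposable M := ~ decomposable M.

End Quadratic.

Section FormKernel.
Variables (K : fieldType) (L : lieAlgType K) (B : invForm L).

Definition form_ker : {pred L} := fun x => `[< forall y, B x y = 0 >].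

Lemma form_kerP x : form_ker x <-> forall y, B x y = 0.
Proof. by split=> /asboolP. Qed.

Lemma form_ker_addr_closed : addr_closed form_ker.
Proof.
split=> [|x y /form_kerP xk /form_kerP yk]; apply/form_kerP => z.
  by rewrite form0l.
by rewrite formDl xk yk addr0.
Qed.
Lemma form_ker_oppr_closed : oppr_closed form_ker.
Proof.
by move=> x /form_kerP xk; apply/form_kerP => z; rewrite formNl xk oppr0.
Qed.
Lemma form_ker_scaler_closed : GRing.scaler_closed form_ker.
Proof.
by move=> a x /form_kerP xk; apply/form_kerP => z; rewrite formZl xk mulr0.
Qed.
Lemma form_ker_lbr x y : form_ker x -> form_ker (lbr x y).
Proof. by move=> /form_kerP xk; apply/form_kerP => z; rewrite inv_lbr xk. Qed.

HB.instance Definition _ := GRing.isAddClosed.Build L form_ker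
  form_ker_addr_closed.
HB.instance Definition _ := GRing.isOppClosed.Build L form_ker
  form_ker_oppr_closed.
HB.instance Definition _ := isLieIdealClosed.Build K L form_ker
  form_ker_scaler_closed form_ker_lbr.

Local Notation Q := (lieQuot form_ker).

Definition bar_form (u v : Q) : K := B (quot_repr u) (quot_repr v).

Lemma bar_formE x y : bar_form (quot_pi _ x) (quot_pi _ y) = B x y.
Proof.
rewrite /bar_form; set x' := quot_repr _; set y' := quot_repr _.
have /form_kerP xk : form_ker (x' - x) by apply: quot_pi_repr.
have /form_kerP yk : form_ker (y' - y) by apply: quot_pi_repr.
apply/eqP; rewrite -subr_eq0.
have -> : B x' y' - B x y = B (x' - x) y' + B x (y' - y).
  by rewrite formBl formBr addrA subrK.
by rewrite xk inv_sym yk addr0.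
Qed.

Lemma bar_form_bilinear :
  bilinear_for (GRing.Scale.Law.clone _ _ *%R _)
    (GRing.Scale.Law.clone _ _ *%R _) bar_form.
Proof.
split=> w a u v; rewrite -[u]quot_reprK -[v]quot_reprK -[w]quot_reprK;
  rewrite -quot_piZ -quot_piD !bar_formE.
  by rewrite formDl formZl.
by rewrite formDr formZr.
Qed.
HB.instance Definition _ := bilinear_isBilinear.Build K Q Q K *%R *%R bar_form
  bar_form_bilinear.

Lemma bar_form_sym u v : bar_form u v = bar_form v u.
Proof. by rewrite /bar_form inv_sym. Qed.
Lemma bar_form_lbr u v w : bar_form (lbr u v) w = bar_form u (lbr v w).
Proof.
rewrite -[u]quot_reprK -[v]quot_reprK -[w]quot_reprK -!quot_pi_lbr !bar_formE.
exact: inv_lbr.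
Qed.
HB.instance Definition _ := isInvariantSym.Build K Q bar_form
  bar_form_sym bar_form_lbr.

Lemma bar_form_nondegenerate : nondegenerate_form bar_form.
Proof.
move=> u uk; rewrite -[u]quot_reprK -(quot_pi0 form_ker).
apply/quot_piP; rewrite subr0; apply/form_kerP => y.
by rewrite -bar_formE quot_reprK.
Qed.

Definition reduced : metricLie K := MetricLie bar_form.

End FormKernel.

(* The free Lie algebra on X: Lie terms over X modulo the congruence         *)
(* generated by the axioms of Lie algebras over K.                           *)

Inductive lterm (K : fieldType) (X : Type) : Type :=
| LGen of X
| LZero
| LAdd of lterm K X & lterm K X
| LOpp of lterm K X
| LScale of K & lterm K X
| LBr of lterm K X & lterm K X.
Arguments LGen {K X}.
Arguments LZero {K X}.

Inductive lequiv (K : fieldType) (X : Type) : lterm K X -> lterm K X -> Prop :=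
| lequiv_refl s : lequiv s s
| lequiv_sym s t : lequiv s t -> lequiv t s
| lequiv_trans s t u : lequiv s t -> lequiv t u -> lequiv s u
| lequivD s s' t t' : lequiv s s' -> lequiv t t' ->
    lequiv (LAdd s t) (LAdd s' t')
| lequivN s s' : lequiv s s' -> lequiv (LOpp s) (LOpp s')
| lequivZ a s s' : lequiv s s' -> lequiv (LScale a s) (LScale a s')
| lequivB s s' t t' : lequiv s s' -> lequiv t t' ->
    lequiv (LBr s t) (LBr s' t')
| ladd_assoc s t u : lequiv (LAdd s (LAdd t u)) (LAdd (LAdd s t) u)
| ladd_comm s t : lequiv (LAdd s t) (LAdd t s)
| ladd_zero s : lequiv (LAdd LZero s) s
| ladd_opp s : lequiv (LAdd (LOpp s) s) LZero
| lscale_scale a b s : lequiv (LScale a (LScale b s)) (LScale (a * b) s)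
| lscale_one s : lequiv (LScale 1 s) s
| lscale_addr a s t :
    lequiv (LScale a (LAdd s t)) (LAdd (LScale a s) (LScale a t))
| lscale_addl a b s : lequiv (LScale (a + b) s) (LAdd (LScale a s) (LScale b s))
| lbr_addl s t u : lequiv (LBr (LAdd s t) u) (LAdd (LBr s u) (LBr t u))
| lbr_scalel a s u : lequiv (LBr (LScale a s) u) (LScale a (LBr s u))
| lbr_addr s t u : lequiv (LBr u (LAdd s t)) (LAdd (LBr u s) (LBr u t))
| lbr_scaler a s u : lequiv (LBr u (LScale a s)) (LScale a (LBr u s))
| lbr_alt s : lequiv (LBr s s) LZero
| lbr_jac s t u :
    lequiv (LAdd (LAdd (LBr (LBr s t) u) (LBr (LBr t u) s)) (LBr (LBr u s) t))
      LZero.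

Section FreeLie.
Variables (K : fieldType) (X : Type).
Local Notation T := (lterm K X).

HB.instance Definition _ := gen_eqMixin T.
HB.instance Definition _ := gen_choiceMixin T.

Definition lequivb (s t : T) : bool := `[< lequiv s t >].

Lemma lequivb_equiv : equiv_class_of lequivb.
Proof.
split=> [s|s t|t s u].
- by apply/asboolP; apply: lequiv_refl.
- by apply/idP/idP => /asboolP H; apply/asboolP; apply: lequiv_sym.
- move=> /asboolP st /asboolP tu; apply/asboolP; exact: lequiv_trans st tu.
Qed.
Canonical lequivb_rel := EquivRelPack lequivb_equiv.
Canonical lequivb_enc := defaultEncModRel lequivb.

Definition freeLie : Type := {eq_quot lequivb}.
HB.instance Definition _ := Choice.on freeLie.

Definition lpi (s : T) : freeLie := \pi_({eq_quot lequivb}) s.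
Definition lrepr (u : freeLie) : T := repr (u : {eq_quot lequivb}).

Lemma lreprK u : lpi (lrepr u) = u. Proof. exact: reprK. Qed.
Lemma lpiP s t : lpi s = lpi t <-> lequiv s t.
Proof.
split=> [/eqP|H]; first by rewrite eqmodE => /asboolP.
by apply/eqP; rewrite eqmodE; apply/asboolP.
Qed.
Lemma lrepr_pi s : lequiv (lrepr (lpi s)) s.
Proof. by apply/lpiP; rewrite lreprK. Qed.

Definition fl_zero := lpi LZero.
Definition fl_add u v := lpi (LAdd (lrepr u) (lrepr v)).
Definition fl_opp u := lpi (LOpp (lrepr u)).
Definition fl_scale a u := lpi (LScale a (lrepr u)).
Definition fl_lbr u v := lpi (LBr (lrepr u) (lrepr v)).

Lemma fl_addE s t : fl_add (lpi s) (lpi t) = lpi (LAdd s t).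
Proof. by apply/lpiP; apply: lequivD; apply: lrepr_pi. Qed.
Lemma fl_oppE s : fl_opp (lpi s) = lpi (LOpp s).
Proof. by apply/lpiP; apply: lequivN; apply: lrepr_pi. Qed.
Lemma fl_scaleE a s : fl_scale a (lpi s) = lpi (LScale a s).
Proof. by apply/lpiP; apply: lequivZ; apply: lrepr_pi. Qed.
Lemma fl_lbrE s t : fl_lbr (lpi s) (lpi t) = lpi (LBr s t).
Proof. by apply/lpiP; apply: lequivB; apply: lrepr_pi. Qed.

Let flE := (fl_addE, fl_oppE, fl_scaleE, fl_lbrE).

Lemma fl_addA : associative fl_add.
Proof.
move=> u v w; rewrite -[u]lreprK -[v]lreprK -[w]lreprK !flE.
by apply/lpiP; constructor.
Qed.
Lemma fl_addC : commutative fl_add.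
Proof.
by move=> u v; rewrite -[u]lreprK -[v]lreprK !flE; apply/lpiP; constructor.
Qed.
Lemma fl_add0 : left_id fl_zero fl_add.
Proof. by move=> u; rewrite -[u]lreprK !flE; apply/lpiP; constructor. Qed.
Lemma fl_addN : left_inverse fl_zero fl_opp fl_add.
Proof. by move=> u; rewrite -[u]lreprK !flE; apply/lpiP; constructor. Qed.
HB.instance Definition _ :=
  GRing.isZmodule.Build freeLie fl_addA fl_addC fl_add0 fl_addN.

Lemma lpiD s t : lpi s + lpi t = lpi (LAdd s t).
Proof. exact: fl_addE. Qed.

Lemma fl_scalerA a b u : fl_scale a (fl_scale b u) = fl_scale (a * b) u.
Proof. by rewrite -[u]lreprK !flE; apply/lpiP; constructor. Qed.
Lemma fl_scale1r : left_id 1 fl_scale.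
Proof. by move=> u; rewrite -[u]lreprK !flE; apply/lpiP; constructor. Qed.
Lemma fl_scalerDr : right_distributive fl_scale +%R.
Proof.
move=> a u v; rewrite -[u]lreprK -[v]lreprK lpiD !flE lpiD.
by apply/lpiP; constructor.
Qed.
Lemma fl_scalerDl u : {morph fl_scale^~ u : a b / a + b}.
Proof.
by move=> a b; rewrite -[u]lreprK !flE lpiD; apply/lpiP; constructor.
Qed.
HB.instance Definition _ := GRing.Zmodule_isLmodule.Build K freeLie
  fl_scalerA fl_scale1r fl_scalerDr fl_scalerDl.

Lemma lpiZ a s : a *: lpi s = lpi (LScale a s).
Proof. exact: fl_scaleE. Qed.

Lemma fl_lbr_linearl w : linear (fun u => fl_lbr u w).
Proof.
move=> a u v; rewrite -[u]lreprK -[v]lreprK -[w]lreprK.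
rewrite lpiZ lpiD !fl_lbrE lpiZ lpiD; apply/lpiP.
by apply: lequiv_trans; [apply: lbr_addl|apply: lequivD; constructor].
Qed.
Lemma fl_lbr_linearr w : linear (fl_lbr w).
Proof.
move=> a u v; rewrite -[u]lreprK -[v]lreprK -[w]lreprK.
rewrite lpiZ lpiD !fl_lbrE lpiZ lpiD; apply/lpiP.
by apply: lequiv_trans; [apply: lbr_addr|apply: lequivD; constructor].
Qed.
Lemma fl_lbrxx u : fl_lbr u u = 0.
Proof. by rewrite -[u]lreprK flE; apply/lpiP; constructor. Qed.
Lemma fl_lbr_jacobi u v w :
  fl_lbr (fl_lbr u v) w + fl_lbr (fl_lbr v w) u + fl_lbr (fl_lbr w u) v = 0.
Proof.
rewrite -[u]lreprK -[v]lreprK -[w]lreprK !fl_lbrE !lpiD.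
by apply/lpiP; constructor.
Qed.
HB.instance Definition _ := Lmodule_isLie.Build K freeLie
  fl_lbr_linearl fl_lbr_linearr fl_lbrxx fl_lbr_jacobi.

Lemma lpiB s t : lbr (lpi s) (lpi t) = lpi (LBr s t).
Proof. exact: fl_lbrE. Qed.

Definition free_gen (x : X) : freeLie := lpi (LGen x).

Variables (L : lieAlgType K) (f : X -> L).

Fixpoint leval (s : T) : L :=
  match s with
  | LGen x => f x
  | LZero => 0
  | LAdd s t => leval s + leval t
  | LOpp s => - leval s
  | LScale a s => a *: leval s
  | LBr s t => lbr (leval s) (leval t)
  end.

Lemma leval_equiv s t : lequiv s t -> leval s = leval t.
Proof.
elim=> //=.
- by move=> {}s {}t u _ -> _ ->.
- by move=> {}s s' {}t t' _ -> _ ->.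
- by move=> {}s s' _ ->.
- by move=> a {}s s' _ ->.
- by move=> {}s s' {}t t' _ -> _ ->.
- by move=> *; rewrite addrA.
- by move=> *; rewrite addrC.
- by move=> *; rewrite add0r.
- by move=> *; rewrite addNr.
- by move=> *; rewrite scalerA.
- by move=> *; rewrite scale1r.
- by move=> *; rewrite scalerDr.
- by move=> *; rewrite scalerDl.
- by move=> *; rewrite lbrDl.
- by move=> *; rewrite lbrZl.
- by move=> *; rewrite lbrDr.
- by move=> *; rewrite lbrZr.
- by move=> *; rewrite lbrxx.
- by move=> *; rewrite lbr_jacobi.
Qed.

Definition free_lift (u : freeLie) : L := leval (lrepr u).

Lemma free_lift_pi s : free_lift (lpi s) = leval s.
Proof. by apply: leval_equiv; apply: lrepr_pi. Qed.

Lemma free_lift_gen x : free_lift (free_gen x) = f x.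
Proof. exact: free_lift_pi. Qed.

Lemma free_lift_morphism : lie_morphism free_lift.
Proof.
split=> [a u v|u v]; rewrite -[u]lreprK -[v]lreprK.
  by rewrite lpiZ lpiD !free_lift_pi.
by rewrite lpiB !free_lift_pi.
Qed.

End FreeLie.

Definition freeNil (K : fieldType) (d t : nat) : lieAlgType K :=
  lieQuot (lcs (freeLie K 'I_d) t.+1 : lieIdeal _).

Definition free_nil_gen (K : fieldType) (d t : nat) (i : 'I_d) : freeNil K d t :=
  quot_pi _ (free_gen K i).

Section HallBasis.
Variables (K : fieldType) (t : nat).

(* The basis vectors are numbered from 1; indices out of range give 0.       *)
Definition hx1 : freeNil K 2 t := free_nil_gen K t ord0.
Definition hx2 : freeNil K 2 t := free_nil_gen K t ord_max.
Definition hall (i : nat) : freeNil K 2 t :=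
  let h3 := lbr hx2 hx1 in
  let h4 := lbr h3 hx1 in let h5 := lbr h3 hx2 in
  let h6 := lbr h4 hx1 in let h7 := lbr h4 hx2 in let h8 := lbr h5 hx2 in
  match i with
  | 1 => hx1 | 2 => hx2 | 3 => h3 | 4 => h4 | 5 => h5 | 6 => h6 | 7 => h7
  | 8 => h8 | 9 => lbr h6 hx1 | 10 => lbr h6 hx2 | 11 => lbr h4 h3
  | 12 => lbr h7 hx2 | 13 => lbr h5 h3 | 14 => lbr h8 hx2
  | _ => 0%R
  end%N.

End HallBasis.

(* hall_table x y k is the coordinate on h_k of [x, y], for x and y given by  *)
(* their coordinates in (h_1, ..., h_14).  The sums come from                *)
(* [h_5, h_1] = h_7, [h_7, h_1] = h_10 + h_11 and [h_8, h_1] = h_12 + h_13.  *)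
(* hallCoord n is the Lie algebra with this product truncated at h_n:        *)
(* n_{2,3} in coordinates for n = 5, n_{2,5} in coordinates for n = 14.      *)
(* The values at indices outside 1, ..., n play no role.                     *)
Definition minor2 (K : fieldType) (x y : nat -> K) (i j : nat) : K :=
  x i * y j - x j * y i.

Definition hall_table (K : fieldType) (x y : nat -> K) (k : nat) : K :=
  match k with
  | 3 => minor2 x y 2 1
  | 4 => minor2 x y 3 1
  | 5 => minor2 x y 3 2
  | 6 => minor2 x y 4 1
  | 7 => (minor2 x y 4 2 + minor2 x y 5 1)%R
  | 8 => minor2 x y 5 2
  | 9 => minor2 x y 6 1
  | 10 => (minor2 x y 6 2 + minor2 x y 7 1)%R
  | 11 => (minor2 x y 4 3 + minor2 x y 7 1)%R
  | 12 => (minor2 x y 7 2 + minor2 x y 8 1)%R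
  | 13 => (minor2 x y 5 3 + minor2 x y 8 1)%R
  | 14 => minor2 x y 8 2
  | _ => 0%R
  end%N.

Definition hall_weight (k : nat) : nat := nth 0%N
  [:: 0; 1; 1; 2; 3; 3; 4; 4; 4; 5; 5; 5; 5; 5; 5]%N k.

Definition hallCoord (K : fieldType) (n : nat) : Type := nat -> K.

Section HallCoord.
Variables (K : fieldType) (n : nat).
Local Notation M := (hallCoord K n).

HB.instance Definition _ := GRing.Lmodule.copy M (nat -> K^o).

Definition hc_lbr (x y : M) : M :=
  fun k => if (k <= n)%N then hall_table x y k else 0.

Lemma hc_lbr_linearl z : linear (fun x => hc_lbr x z).
Proof.
move=> a x y; apply/funext => k.
change (hc_lbr (a *: x + y) z k = a * hc_lbr x z k + hc_lbr y z k).
rewrite /hc_lbr; case: ifP => _; last by ring.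
rewrite /hall_table /minor2.
have E i : (a *: x + y) i = a * x i + y i by [].
by do 15 (case: k => [|k] /=; first by rewrite ?E; ring); ring.
Qed.
Lemma hc_lbrC x y : hc_lbr x y = - hc_lbr y x.
Proof.
apply/funext => k.
change (hc_lbr x y k = - hc_lbr y x k).
rewrite /hc_lbr.
case: ifP => _; last by ring.
by rewrite /hall_table /minor2; do 15 (case: k => [|k] /=; first by ring); ring.
Qed.
Lemma hc_lbr_linearr z : linear (hc_lbr z).
Proof.
move=> a x y; rewrite hc_lbrC (hc_lbr_linearl z a x y) /=.
by rewrite (hc_lbrC z x) (hc_lbrC z y) opprD scalerN.
Qed.
Lemma hc_lbrxx x : hc_lbr x x = 0.
Proof.
apply/funext => k.
change (hc_lbr x x k = 0).
rewrite /hc_lbr; case: ifP => _ //.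
by rewrite /hall_table /minor2; do 15 (case: k => [|k] /=; first by ring); ring.
Qed.
Lemma hc_lbr_jacobi x y z :
  hc_lbr (hc_lbr x y) z + hc_lbr (hc_lbr y z) x + hc_lbr (hc_lbr z x) y = 0.
Proof.
apply/funext => k.
change (hc_lbr (hc_lbr x y) z k + hc_lbr (hc_lbr y z) x k
        + hc_lbr (hc_lbr z x) y k = 0).
rewrite {1 3 5}/hc_lbr; case: ifP => kn; last by ring.
have E u v i : (i <= k)%N -> hc_lbr u v i = hall_table u v i.
  by move=> ik; rewrite /hc_lbr (leq_trans ik kn).
rewrite /hall_table /minor2.
do 15 (case: k kn E => [|k] kn E /=;
  first by rewrite ?E // /hall_table /minor2 /=; ring).
by ring.
Qed.

HB.instance Definition _ := Lmodule_isLie.Build K M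
  hc_lbr_linearl hc_lbr_linearr hc_lbrxx hc_lbr_jacobi.

Definition hc_filt (i : nat) : {pred M} := fun x =>
  `[< forall k, (hall_weight k < i)%N || (n < k)%N -> x k = 0 >].

Lemma hc_filt_addr_closed i : addr_closed (hc_filt i).
Proof.
split=> [|x y /asboolP xi /asboolP yi]; apply/asboolP => // k ki.
by change (x k + y k = 0); rewrite xi // yi // addr0.
Qed.
Lemma hc_filt_scaler_closed i : GRing.scaler_closed (hc_filt i).
Proof.
move=> a x /asboolP xi; apply/asboolP => k ki.
by change (a * x k = 0); rewrite xi // mulr0.
Qed.
HB.instance Definition _ i := GRing.isAddClosed.Build M (hc_filt i)
  (hc_filt_addr_closed i).
HB.instance Definition _ i := GRing.isScaleClosed.Build K M (hc_filt i)
  (@hc_filt_scaler_closed i).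

Lemma hc_lbr_filt i (x y : M) :
  (forall k, (0 < hall_weight k < i)%N -> x k = 0) -> hc_filt i.+1 (lbr x y).
Proof.
move=> xi; apply/asboolP => k; rewrite ltnS.
change (lbr x y k) with (hc_lbr x y k); rewrite /hc_lbr.
case: leqP => //= _; rewrite orbF /hall_table /minor2.
do 15 (case: k => [|k]; first
  by rewrite /hall_weight /= => ki;
     rewrite ?(xi 1%N) ?(xi 2%N) ?(xi 3%N) ?(xi 4%N) ?(xi 5%N) ?(xi 6%N)
       ?(xi 7%N) ?(xi 8%N) ?mul0r ?mulr0 ?subr0 ?addr0 //=;
     apply: leq_trans ki).
by [].
Qed.

Lemma lcs_hc_filt i x : lcs (M : lieAlgType K) i.+2 x -> hc_filt i.+2 x.
Proof.
elim: i x => [|i IH] x /lin_spanP H; apply: (H (hc_filt _ : submodClosed M)).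
  move=> _ [y [z [_ ->]]]; apply: hc_lbr_filt => k.
  by rewrite ltnS; case: hall_weight.
move=> _ [y [z [/IH/asboolP yi ->]]]; apply: hc_lbr_filt => k /andP[_ ki].
by apply: yi; rewrite ki.
Qed.

End HallCoord.

Lemma lcs_morphism (K : fieldType) (L M : lieAlgType K) (f : L -> M) i x :
  lie_morphism f -> lcs L i x -> lcs M i (f x).
Proof.
move=> [fl fb]; rewrite /lcs; elim: i.-1 x => // {}i IH x /=.
have f0 : f 0 = 0 by have := fl (-1) 0 0; rewrite scaler0 addr0 scaleN1r addNr.
pose S y := lin_span (fun z => exists x y, lcs_rec i x /\ z = lbr x y) (f y).
have SD : addr_closed S.
  split=> [|u v]; first by rewrite unfold_in /S f0 lin_span0.
  rewrite !unfold_in /S => Su Sv; have := fl 1 u v; rewrite !scale1r => ->.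
  exact: lin_spanD.
have SZ : GRing.scaler_closed S.
  move=> a u; rewrite !unfold_in /S => Su; have := fl a u 0.
  by rewrite f0 !addr0 => ->; apply: lin_spanZ.
pose SA := GRing.isAddClosed.Build L S SD.
pose SB := GRing.isScaleClosed.Build K L S SZ.
pose T : submodClosed L := HB.pack S SA SB.
move=> /lin_spanP /(_ T); apply=> _ [y [z [yi ->]]].
change (S (lbr y z)); rewrite /S fb; apply: mem_lin_span.
by exists (f y), (f z); split=> //; apply: IH.
Qed.

Section Coord.
Variables (K : fieldType) (t n : nat).

(* The coordinates in the basis (h_1, ..., h_n), see coord_hall; meaningful   *)
(* for (t, n) = (3, 5) and (5, 14) only.                                     *)
Definition coord : freeNil K 2 t -> hallCoord K n :=
  quot_lift (free_lift (fun i : 'I_2 =>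
    (fun k => (k == i.+1)%:R) : hallCoord K n)).

Hypothesis tn : (t == 3) && (n == 5) || (t == 5) && (n == 14).

Lemma coord_lcs x : x \in lcs (freeLie K 'I_2) t.+1 ->
  free_lift (fun i : 'I_2 => (fun k => (k == i.+1)%:R) : hallCoord K n) x = 0.
Proof.
move=> xt.
have := lcs_morphism (free_lift_morphism (fun i : 'I_2 =>
  (fun k => (k == i.+1)%:R) : hallCoord K n)) xt.
set y := free_lift _ _.
have -> : t.+1 = t.-1.+2 by case/orP: tn => /andP[/eqP -> _].
move=> /lcs_hc_filt/asboolP yt; apply/funext => k; apply: yt.
case/orP: tn => /andP[/eqP -> /eqP ->]; rewrite /hall_weight.
  by do 6 (case: k => [//|k]); rewrite orbT.
by do 15 (case: k => [//|k]); rewrite orbT.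
Qed.

Lemma coord_morphism : lie_morphism coord.
Proof. exact: quot_lift_morphism (free_lift_morphism _) coord_lcs. Qed.

Lemma coordB x y : coord (lbr x y) = hc_lbr (coord x) (coord y).
Proof. by have [_ ->] := coord_morphism. Qed.

Lemma coord_hall i : (0 < i <= n)%N ->
  coord (hall K t i) = (fun k => (k == i)%:R).
Proof.
have D u v w x y : coord x = (fun k => (k == u)%:R) ->
    coord y = (fun k => (k == v)%:R) ->
    (forall k, hall_table (fun k => (k == u)%:R) (fun k => (k == v)%:R) k
       = (k == w)%:R :> K) -> (w <= n)%N ->
    coord (lbr x y) = (fun k => (k == w)%:R).
  move=> xu yv T wn; rewrite coordB xu yv; apply/funext => k.
  rewrite /hc_lbr T; case: (leqP k n) => // kn.
  by case: eqP => // kw; rewrite kw ltnNge wn in kn.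
have q (r : 'I_2) : coord (quot_pi _ (free_gen K r)) = (fun k => (k == r.+1)%:R).
  rewrite /coord (quot_liftE (free_lift_morphism _) coord_lcs).
  by rewrite free_lift_gen.
have h1 : coord (hall K t 1) = (fun k => (k == 1)%N%:R) by apply: q.
have h2 : coord (hall K t 2) = (fun k => (k == 2)%N%:R) by apply: q.
pose P w := (w <= n)%N -> coord (hall K t w) = (fun k => (k == w)%:R).
have S u v w : (u < w)%N -> (v < w)%N -> P u -> P v ->
    hall K t w = lbr (hall K t u) (hall K t v) ->
    (forall k, hall_table (fun k => (k == u)%:R) (fun k => (k == v)%:R) k
       = (k == w)%:R :> K) -> P w.
  move=> uw vw Pu Pv E T wn; rewrite E; apply: (D u v) => //.
    by apply: Pu; apply: leq_trans wn; apply: ltnW.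
  by apply: Pv; apply: leq_trans wn; apply: ltnW.
have P1 : P 1 by []. have P2 : P 2 by [].
have T k : all (fun p : nat * nat * nat =>
      hall_table (fun k => (k == p.1.1)%:R) (fun k => (k == p.1.2)%:R) k
      == (k == p.2)%:R :> K)
    [:: (2,1,3); (3,1,4); (3,2,5); (4,1,6); (4,2,7); (5,2,8); (6,1,9);
        (6,2,10); (4,3,11); (7,2,12); (5,3,13); (8,2,14)]%N.
  rewrite /= /hall_table /minor2.
  do 15 (case: k => [|k]; first
    by do ?(apply/andP; split=> //); apply/eqP; rewrite /=; ring).
  by rewrite /= !eqxx.
have {}T u v w : (u, v, w) \in [:: (2,1,3); (3,1,4); (3,2,5); (4,1,6); (4,2,7);
      (5,2,8); (6,1,9); (6,2,10); (4,3,11); (7,2,12); (5,3,13); (8,2,14)]%N ->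
    forall k, hall_table (fun k => (k == u)%:R) (fun k => (k == v)%:R) k
      = (k == w)%:R :> K.
  by move=> uvw k; have /allP/(_ _ uvw)/eqP := T k.
have P3 : P 3 by apply: (S 2 1) => //; exact: T.
have P4 : P 4 by apply: (S 3 1) => //; exact: T.
have P5 : P 5 by apply: (S 3 2) => //; exact: T.
have P6 : P 6 by apply: (S 4 1) => //; exact: T.
have P7 : P 7 by apply: (S 4 2) => //; exact: T.
have P8 : P 8 by apply: (S 5 2) => //; exact: T.
have P9 : P 9 by apply: (S 6 1) => //; exact: T.
have P10 : P 10 by apply: (S 6 2) => //; exact: T.
have P11 : P 11 by apply: (S 4 3) => //; exact: T.
have P12 : P 12 by apply: (S 7 2) => //; exact: T.
have P13 : P 13 by apply: (S 5 3) => //; exact: T.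
have P14 : P 14 by apply: (S 8 2) => //; exact: T.
case: i => // i /andP[_]; move: i.
do 14 (case=> //).
move=> i; case/orP: tn => /andP[_ /eqP ->]; by rewrite ltnNge.
Qed.

End Coord.

Definition sym2 (K : fieldType) (x y : nat -> K) (i j : nat) : K :=
  x i * y j + x j * y i.

Section Form23.
Variables (K : fieldType) (g : K).

Definition form23 (u v : freeNil K 2 3) : K :=
  let x := coord 5 u in let y := coord 5 v in
  g * (sym2 x y 1 5 - sym2 x y 2 4 + x 3%N * y 3%N).

Lemma form23_bilinear :
  bilinear_for (GRing.Scale.Law.clone _ _ *%R _)
    (GRing.Scale.Law.clone _ _ *%R _) form23.
Proof.
have [cl _] := @coord_morphism K 3 5 isT.
split=> w a u v; rewrite /form23 cl /sym2; set x := coord 5 u;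
  set y := coord 5 v; set z := coord 5 w;
  have E i : (a *: x + y) i = a * x i + y i by [];
  by rewrite !E /=; ring.
Qed.
HB.instance Definition _ := bilinear_isBilinear.Build K (freeNil K 2 3)
  (freeNil K 2 3) K *%R *%R form23 form23_bilinear.

Lemma form23_sym u v : form23 u v = form23 v u.
Proof. by rewrite /form23 /sym2; ring. Qed.
Lemma form23_lbr u v w : form23 (lbr u v) w = form23 u (lbr v w).
Proof.
rewrite /form23 /= !(@coordB K 3 5 isT) /sym2 /hc_lbr /= /hall_table /minor2.
by ring.
Qed.
HB.instance Definition _ := isInvariantSym.Build K (freeNil K 2 3) form23
  form23_sym form23_lbr.

Definition metric23 : metricLie K := MetricLie form23.

End Form23.

Section Form25.
Variables (K : fieldType) (A : 'M[K]_2).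

Definition form25 (u v : freeNil K 2 5) : K :=
  let x := coord 14 u in let y := coord 14 v in
  let d := A 0 0 in let e := A 0 1 in let f := A 1 1 in
  d * (x 4%N * y 4%N) + e * sym2 x y 4 5 + f * (x 5%N * y 5%N)
  - d * sym2 x y 3 6 - e * sym2 x y 3 7 - f * sym2 x y 3 8
  - d * sym2 x y 1 10 + d * sym2 x y 1 11 - e * sym2 x y 1 12
  + e * sym2 x y 1 13 - f * sym2 x y 1 14
  + d * sym2 x y 2 9 + e * sym2 x y 2 11 + f * sym2 x y 2 13.

Lemma form25_bilinear :
  bilinear_for (GRing.Scale.Law.clone _ _ *%R _)
    (GRing.Scale.Law.clone _ _ *%R _) form25.
Proof.
have [cl _] := @coord_morphism K 5 14 isT.
split=> w a u v; rewrite /form25 cl /sym2; set x := coord 14 u;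
  set y := coord 14 v; set z := coord 14 w;
  have E i : (a *: x + y) i = a * x i + y i by [];
  by rewrite !E /=; ring.
Qed.
HB.instance Definition _ := bilinear_isBilinear.Build K (freeNil K 2 5)
  (freeNil K 2 5) K *%R *%R form25 form25_bilinear.

Lemma form25_sym u v : form25 u v = form25 v u.
Proof. by rewrite /form25 /sym2; ring. Qed.
Lemma form25_lbr u v w : form25 (lbr u v) w = form25 u (lbr v w).
Proof.
rewrite /form25 /= !(@coordB K 5 14 isT) /sym2 /hc_lbr /= /hall_table /minor2.
by ring.
Qed.
HB.instance Definition _ := isInvariantSym.Build K (freeNil K 2 5) form25
  form25_sym form25_lbr.

Definition metric25 : metricLie K := reduced form25.

End Form25.

(* The lists ((i, j), B(h_i, h_j)) of the values not required to be 0; the    *)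
(* lemmas form23_hall and form25_hall say that form23 and form25 have the    *)
(* values which define the forms on the bases.                               *)

Definition sym_table (K : fieldType) (s : seq (nat * nat * K)) (i j : nat) : K :=
  \sum_(p <- s) if (p.1 == (i, j)) || (p.1 == (j, i)) then p.2 else 0.

Definition table23 (K : fieldType) (g : K) : seq (nat * nat * K) :=
  [:: (1%N, 5%N, g); (2%N, 4%N, - g); (3%N, 3%N, g)].

Definition table25 (K : fieldType) (A : 'M[K]_2) : seq (nat * nat * K) :=
  let d := A 0 0 in let e := A 0 1 in let f := A 1 1 in
  [:: (4%N, 4%N, d); (4%N, 5%N, e); (5%N, 5%N, f);
      (3%N, 6%N, - d); (3%N, 7%N, - e); (3%N, 8%N, - f);
      (1%N, 10%N, - d); (1%N, 11%N, d); (1%N, 12%N, - e); (1%N, 13%N, e);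
      (1%N, 14%N, - f); (2%N, 9%N, d); (2%N, 11%N, e); (2%N, 13%N, f)].

Lemma form23_hall (K : fieldType) (g : K) (i j : nat) :
  (0 < i <= 5)%N -> (0 < j <= 5)%N ->
  form23 g (hall K 3 i) (hall K 3 j) = sym_table (table23 g) i j.
Proof.
move=> i5 j5; rewrite /form23 !(@coord_hall K 3 5 isT) // /sym_table /table23.
rewrite !big_cons big_nil /sym2.
case: i i5 => [//|i] i5; case: j j5 => [//|j] j5.
do 5 (case: i i5 => [_|i i5]; first
  by do 5 (case: j j5 => [_|j j5]; first by rewrite /=; ring)).
by [].
Qed.

Lemma form25_hall (K : fieldType) (A : 'M[K]_2) (i j : nat) :
  (0 < i <= 14)%N -> (0 < j <= 14)%N ->
  form25 A (hall K 5 i) (hall K 5 j) = sym_table (table25 A) i j.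
Proof.
move=> i14 j14; rewrite /form25 !(@coord_hall K 5 14 isT) // /sym_table /table25.
rewrite !big_cons big_nil /sym2.
case: i i14 => [//|i] i14; case: j j14 => [//|j] j14.
do 14 (case: i i14 => [_|i i14]; first
  by do 14 (case: j j14 => [_|j j14]; first by rewrite /=; ring)).
by [].
Qed.

Definition congruent (K : fieldType) (n : nat) (A B : 'M[K]_n) :=
  exists2 P : 'M[K]_n, P \in unitmx & B = P^T *m A *m P.

(* The elements of the group K^* / (K^* )^2 are the cosets of (K^* )^2.      *)
Definition sq_coset (K : fieldType) (a : K) : set K :=
  [set b | exists2 k, k != 0 & b = a * k ^+ 2].
Definition sq_cosets (K : fieldType) : set (set K) :=
  [set sq_coset a | a in [set a | a != 0]].
Arguments sq_cosets : clear implicits.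

(* c induces a bijection from {x | P x} modulo R onto C.  This is spelled out *)
(* because metricLie K is too large for the universe of classical_sets.set,  *)
(* which rules out card_eq on sets of classes of metric Lie algebras.        *)
Definition classes_in_bijection (T U : Type) (P : T -> Prop)
    (R : T -> T -> Prop) (C : set U) :=
  exists c : T -> U,
    [/\ forall x, P x -> C (c x),
        forall x y, P x -> P y -> (R x y <-> c x = c y)
      & forall u, C u -> exists2 x, P x & c x = u].

(* Main.v *)
(*
Let y0, y1 generate a nilpotent quadratic Lie algebra M of type 2, and put
h3 = [y1, y0], h4 = [h3, y0], h5 = [h3, y1].  By invariance, whether M^i and M^j
are orthogonal depends on i + j only, and they are if i + j > t + 1.  Because
M^2 = K h3 + M^3 and M^3 = K h4 + K h5 + M^4, and because h3 is orthogonal to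
y0, y1, h4 and h5, an invariant form on an algebra with M^6 = 0 is determined by
the Gram matrices of (y0, y1), (h3) and (h4, h5).  For t = 2 and t = 4 this
already makes M^t orthogonal to M.  For t = 5 (t = 3) the Gram matrix A of
(h4, h5) (the value c = B(h3, h3)) is nonzero, and invariance gives elements of
M^t dual to y0 and y1.  Adding suitable elements of M^3 and M^t to the
generators makes B(h3, h3) (if t = 5) and the B(y_i, y_j) vanish without
changing A (or c), and then the form of M pulls back to the form of the model
on the free nilpotent algebra.  The same filtration argument shows that
generators with matrix P modulo M^2 replace A by (det P)^2 P^t A P, and c by
(det P)^2 c.
*)
Require Import Defs.
From HB Require Import structures.
From mathcomp Require Import all_boot all_order all_algebra.
From mathcomp Require Import boolp classical_sets.
From mathcomp Require Import ring.

Set Implicit Arguments.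
Unset Strict Implicit.
Unset Printing Implicit Defensive.

Import GRing.Theory.
(* The sesquilinear library also has lemmas named formDl, formZl, and so on. *)
Import Defs.
Local Open Scope ring_scope.

(** * Two-by-two matrices and bijections *)

Lemma ord2P (i : 'I_2) : i = 0 \/ i = 1.
Proof. by case: i => [[|[|//]] ?]; [left|right]; apply: val_inj. Qed.

Lemma sum_ord2 (V : nmodType) (F : 'I_2 -> V) : \sum_i F i = F 0 + F 1.
Proof. by rewrite big_ord_recl big_ord1; congr (_ + F _); apply: val_inj. Qed.

(** The factors are ordered as in the coefficient of [lbr_comb_lcs], which [gen3_change] applies
    after this rewriting. *)
Lemma det2 (R : comNzRingType) (P : 'M[R]_2) :
  \det P = P 1 1 * P 0 0 - P 0 1 * P 1 0.
Proof.
rewrite (expand_det_row _ 0) sum_ord2 /cofactor !det_mx11 !mxE /=.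
have -> : lift (0 : 'I_2) 0 = 1 by apply: val_inj.
have -> : lift (1 : 'I_2) 0 = 0 by apply: val_inj.
by rewrite expr0 expr1; ring.
Qed.

Lemma injective_surjective_bij (T U : Type) (f : T -> U) :
  injective f -> (forall y, exists x, f x = y) -> bijective f.
Proof.
move=> fI /choice[g fK]; exists g => // x; apply: fI; exact: fK.
Qed.

(** * Morphisms of Lie algebras *)

Section Morphisms.
Variable K : fieldType.
Implicit Types L M N : lieAlgType K.

Lemma lie_morphism0 L M (f : L -> M) : lie_morphism f -> f 0 = 0.
Proof.
by case=> fl _; have := fl (-1) 0 0; rewrite scaler0 addr0 scaleN1r addNr.
Qed.

Lemma lie_morphismD L M (f : L -> M) : lie_morphism f -> {morph f : x y / x + y}.
Proof. by case=> fl _ x y; have := fl 1 x y; rewrite !scale1r. Qed.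

Lemma lie_morphismZ L M (f : L -> M) a : lie_morphism f -> {morph f : x / a *: x}.
Proof.
by move=> fP x; have [/(_ a x 0) + _] := fP; rewrite (lie_morphism0 fP) !addr0.
Qed.

Lemma lie_morphismB L M (f : L -> M) : lie_morphism f -> {morph f : x y / x - y}.
Proof.
move=> fP x y; rewrite (lie_morphismD fP) -scaleN1r (lie_morphismZ _ fP).
by rewrite scaleN1r.
Qed.

Lemma lie_morphism_quot_pi L (I : lieIdeal L) : lie_morphism (quot_pi I).
Proof.
split=> [a x y|x y]; first by rewrite quot_piD quot_piZ.
exact: quot_pi_lbr.
Qed.

Lemma quot_pi_surj L (I : lieIdeal L) u : exists x, quot_pi I x = u.
Proof. by exists (quot_repr u); apply: quot_reprK. Qed.

End Morphisms.

(** * The lower central series *)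

Section LowerCentral.
Variables (K : fieldType) (L : lieAlgType K).
Implicit Types x y z m : L.

Lemma mem_lcs1 x : x \in lcs L 1.
Proof. by []. Qed.
Hint Resolve mem_lcs1 : core.

(** [lin_span] quantifies over submodules, so [P], being closed under linear combinations, is
    packaged as one of them. *)
Lemma lcs_ind i (P : L -> Prop) :
    P 0 -> (forall a x y, P x -> P y -> P (a *: x + y)) ->
    (forall x y, x \in lcs L i.+1 -> P (lbr x y)) ->
  forall x, x \in lcs L i.+2 -> P x.
Proof.
move=> P0 PDZ Pbr x.
pose S y := `[< P y >].
have SD : addr_closed S.
  split=> [|u v]; rewrite !unfold_in; first exact/asboolP.
  by move=> /asboolP Pu /asboolP Pv; apply/asboolP; rewrite -[u]scale1r; apply: PDZ.
have SZ : GRing.scaler_closed S.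
  move=> a u; rewrite !unfold_in => /asboolP Pu; apply/asboolP.
  by rewrite -[_ *: _]addr0; apply: PDZ.
pose SA := GRing.isAddClosed.Build L S SD.
pose SB := GRing.isScaleClosed.Build K L S SZ.
pose T : submodClosed L := HB.pack S SA SB.
move=> /lin_spanP /(_ T) TP; suff /asboolP : S x by [].
by apply: TP => _ [y [z [yi ->]]]; apply/asboolP/Pbr.
Qed.

Lemma lcs_lbrS i x y : x \in lcs L i.+1 -> lbr x y \in lcs L i.+2.
Proof. by move=> xi; apply: mem_lin_span; exists x, y. Qed.

Lemma lcs_leq i j x : (i <= j)%N -> x \in lcs L j -> x \in lcs L i.
Proof.
move=> /subnK <-; elim: (j - i)%N => // k IH; rewrite addSn => xk; apply: IH.
case: (k + i)%N xk => // n; exact: lcs_rec_sub.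
Qed.

Lemma lbr_lbrr x y z : lbr x (lbr y z) = lbr (lbr x y) z - lbr (lbr x z) y.
Proof.
apply/eqP; rewrite -subr_eq0; apply/eqP; have := lbr_jacobi x y z.
move=> /(congr1 -%R); rewrite oppr0 => <-; rewrite (lbrC x (lbr y z)).
rewrite (lbrC z x) lbrNl opprB !opprD opprK.
by rewrite -addrA addrC addrAC -!addrA; congr (_ + _); rewrite addrC.
Qed.

(** Induction on [j]: the Jacobi identity gives [x, [p, q]] = [[x, p], q] - [[x, q], p], and [p]
    lies one term higher in the series than [p, q]. *)
Lemma lcs_lbr_add i j x y :
  x \in lcs L i.+1 -> y \in lcs L j.+1 -> lbr x y \in lcs L (i + j).+2.
Proof.
elim: j i x y => [|j IH] i x y xi; first by rewrite addn0 => _; apply: lcs_lbrS.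
move: y; apply: (@lcs_ind j) => [|a p q pP qP|p q pj].
- by rewrite lbr0r rpred0.
- rewrite lbrDr lbrZr; exact: rpredD (lcsZ _ pP) qP.
- rewrite lbr_lbrr rpredB //.
    by rewrite addnS; apply: lcs_lbrS; apply: IH.
  by rewrite addnS -addSn; apply: IH => //; apply: lcs_lbrS.
Qed.

Lemma lcsZ_mem i a x : x \in lcs L i -> a *: x \in lcs L i.
Proof. exact: lcsZ. Qed.

Lemma lcs_vanish i j : (forall x, x \in lcs L i -> x = 0) -> (i <= j)%N ->
  forall x, x \in lcs L j -> x = 0.
Proof. by move=> L0 ij x xj; apply: L0; apply: lcs_leq xj. Qed.

End LowerCentral.
#[local] Hint Resolve mem_lcs1 : core.

(** Both factors of a bracket in M lift along [f], the first one by induction inside the lower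
    central series. *)
Lemma lcs_surj (K : fieldType) (L M : lieAlgType K) (f : L -> M) i x :
  lie_morphism f -> (forall y, exists u, f u = y) -> x \in lcs M i ->
  exists2 u, u \in lcs L i & f u = x.
Proof.
move=> fP fS; case: i => [|i].
  by move=> _; have [u ux] := fS x; exists u.
elim: i x => [|i IH] x; first by move=> _; have [u ux] := fS x; exists u.
move: x; apply: (@lcs_ind _ _ i) => [|a x y [u ui <-] [v vi <-]|x y /IH[u ui <-]].
- by exists 0; rewrite ?rpred0 ?(lie_morphism0 fP).
- exists (a *: u + v); first by rewrite rpredD // lcsZ_mem.
  by rewrite (proj1 fP).
- have [v <-] := fS y; exists (lbr u v); first exact: lcs_lbrS.
  by rewrite (proj2 fP).
Qed.

(** * Pairs of generators and the first layers of the lower central series *)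

Section Generators.
Variables (K : fieldType) (L : lieAlgType K).
Implicit Types (x m : L) (y : 'I_2 -> L).

(** Spanning is required modulo L^2; for nilpotent L, [generating_subalgebra] turns this into
    generation as a Lie algebra. *)
Definition generating y := forall x, exists a b,
  exists2 m, m \in lcs L 2 & x = a *: y 0 + b *: y 1 + m.

Definition gen3 y := lbr (y 1) (y 0).
(** The values at 0 and 1 are h4 and h5 of the pair [y]. *)
Definition gen4 y i := lbr (gen3 y) (y i).

Lemma mem_gen3 y : gen3 y \in lcs L 2.
Proof. exact: lcs_lbrS. Qed.

Lemma mem_gen4 y i : gen4 y i \in lcs L 3.
Proof. exact: lcs_lbrS (mem_gen3 y). Qed.

Lemma lbr_comb y a b c d :
  lbr (a *: y 0 + b *: y 1) (c *: y 0 + d *: y 1) = (b * c - a * d) *: gen3 y.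
Proof.
rewrite !lbrDl !lbrDr !lbrZl !lbrZr !lbrxx !scaler0 add0r addr0.
by rewrite (lbrC (y 0)) !scalerN !scalerA addrC scalerBl.
Qed.

(** Every bracket that involves [m] or [n] falls into L^3. *)
Lemma lbr_comb_lcs y a b c d m n : m \in lcs L 2 -> n \in lcs L 2 ->
  exists2 k, k \in lcs L 3 &
    lbr (a *: y 0 + b *: y 1 + m) (c *: y 0 + d *: y 1 + n) =
      (b * c - a * d) *: gen3 y + k.
Proof.
move=> m2 n2; set u := a *: _ + _; set v := c *: _ + _.
exists (lbr u n + lbr m (v + n)).
  rewrite rpredD //; last exact: lcs_lbrS.
  exact: (@lcs_lbr_add _ _ 0 1).
by rewrite lbrDl (lbrDr _ _ u) lbr_comb -!addrA.
Qed.

Lemma lcs2_gen y x : generating y -> x \in lcs L 2 ->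
  exists c, exists2 m, m \in lcs L 3 & x = c *: gen3 y + m.
Proof.
move=> yg; move: x; apply: (@lcs_ind _ _ 0).
- by exists 0, 0; rewrite ?rpred0 // scale0r addr0.
- move=> a _ _ [c [m m3 ->]] [d [n n3 ->]]; exists (a * c + d), (a *: m + n).
    by rewrite rpredD // lcsZ_mem.
  by rewrite scalerDr scalerA scalerDl addrACA.
- move=> p q _; have [a [b [m m2 ->]]] := yg p; have [c [d [n n2 ->]]] := yg q.
  by have [k k3 ->] := lbr_comb_lcs y a b c d m2 n2; exists (b * c - a * d), k.
Qed.

(** By [lcs2_gen], only the brackets of h3 with the two generators survive modulo L^4. *)
Lemma lcs3_gen y x : generating y -> x \in lcs L 3 ->
  exists a b, exists2 m, m \in lcs L 4 & x = a *: gen4 y 0 + b *: gen4 y 1 + m.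
Proof.
move=> yg; move: x; apply: (@lcs_ind _ _ 1).
- by exists 0, 0, 0; rewrite ?rpred0 // !scale0r !addr0.
- move=> s _ _ [a [b [m m4 ->]]] [c [d [n n4 ->]]].
  exists (s * a + c), (s * b + d), (s *: m + n).
    by rewrite rpredD // lcsZ_mem.
  rewrite !scalerDr !scalerA !scalerDl addrACA; congr (_ + _).
  by rewrite addrACA.
- move=> p q /(lcs2_gen yg)[c [m m3 ->]]; have [a [b [n n2 ->]]] := yg q.
  exists (c * a), (c * b), (lbr (c *: gen3 y) n + lbr m (a *: y 0 + b *: y 1 + n)).
    rewrite rpredD //; last exact: lcs_lbrS.
    rewrite lbrZl; apply: lcsZ_mem; apply: (@lcs_lbr_add _ _ 1 1) => //.
    exact: mem_gen3.
  rewrite lbrDl addrA; congr (_ + _); rewrite lbrDr; congr (_ + _).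
  by rewrite lbrDr !lbrZl !lbrZr !scalerA.
Qed.

Lemma generating_add y y' n : generating y ->
  (forall i, n i \in lcs L 2) -> (forall i, y' i = y i + n i) -> generating y'.
Proof.
move=> yg n2 y'E z; have [a [b [m m2 ->]]] := yg z; exists a, b.
exists (m - (a *: n 0 + b *: n 1)); first by rewrite rpredB // rpredD // lcsZ_mem.
rewrite !y'E !scalerDr [X in _ = X + _]addrACA -[RHS]addrA.
by rewrite [_ + (m - _)]addrC subrK.
Qed.

(** Elements of [S] approximate [x] modulo deeper and deeper terms of the series, and L^(t+1) = 0
    makes the last approximation exact. *)
Lemma generating_subalgebra y t (S : L -> Prop) : generating y ->
    (forall x, x \in lcs L t.+1 -> x = 0) -> (forall i, S (y i)) ->
    (forall a u v, S u -> S v -> S (a *: u + v)) ->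
    (forall u v, S u -> S v -> S (lbr u v)) ->
  forall x, S x.
Proof.
move=> yg Lt Sy SDZ Sbr.
have S0 : S 0 by rewrite -(addNr (y 0)) -scaleN1r; apply: SDZ.
have SZ a u : S u -> S (a *: u) by move=> Su; rewrite -[_ *: _]addr0; apply: SDZ.
have SD u v : S u -> S v -> S (u + v) by rewrite -{2}[u]scale1r; apply: SDZ.
have step i x : x \in lcs L i.+1 -> exists2 s, S s & x - s \in lcs L i.+2.
  elim: i x => [|i IH] x.
    move=> _; have [a [b [m m2 ->]]] := yg x; exists (a *: y 0 + b *: y 1).
      by apply: SDZ => //; apply: SZ.
    by rewrite addrC addrA addNr add0r.
  move: x; apply: (@lcs_ind _ _ i).
  - by exists 0; rewrite ?subr0 ?rpred0.
  - move=> a u v [s Ss us] [s' Ss' vs]; exists (a *: s + s'); first exact: SDZ.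
    rewrite opprD addrACA -scalerBr; exact: rpredD (lcsZ_mem _ us) vs.
  - move=> p q pi; have [s Ss sp] := IH p pi.
    have [a [b [m m2 qE]]] := yg q; exists (lbr s (a *: y 0 + b *: y 1)).
      by apply: Sbr => //; apply: SDZ => //; apply: SZ.
    (* Both error terms lie in L^(i+3), since [m] is in L^2 and [p - s] is in L^(i+2). *)
    have -> : lbr p q - lbr s (a *: y 0 + b *: y 1) =
        lbr p m + lbr (p - s) (a *: y 0 + b *: y 1).
      by rewrite qE [_ + m]addrC lbrDr lbrDl lbrNl addrA.
    rewrite rpredD //; last exact: lcs_lbrS.
    by rewrite -[i]addn0 -addnS; apply: lcs_lbr_add.
move=> x; suff [s Ss /Lt/eqP] : exists2 s, S s & x - s \in lcs L t.+1.
  by rewrite subr_eq0 => /eqP ->.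
elim: t {Lt} => [|i [s Ss /step[s' Ss' xs]]]; first by exists 0; rewrite ?subr0.
by exists (s + s'); [apply: SD|rewrite opprD addrA].
Qed.

End Generators.

Lemma generating_surj (K : fieldType) (L M : lieAlgType K) (f : L -> M)
    (y : 'I_2 -> L) :
  lie_morphism f -> (forall x, exists u, f u = x) -> generating y ->
  generating (fun i => f (y i)).
Proof.
move=> fP fS yg x; have [u <-] := fS x; have [a [b [m m2 ->]]] := yg u.
exists a, b, (f m); first exact: lcs_morphism m2.
by rewrite !(lie_morphismD fP) !(lie_morphismZ _ fP).
Qed.

Lemma gen4_morphism (K : fieldType) (L M : lieAlgType K) (f : L -> M)
    (y : 'I_2 -> L) i :
  lie_morphism f -> f (gen4 y i) = gen4 (f \o y) i.
Proof. by case=> _ fb; rewrite /gen4 /gen3 !fb. Qed.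

(** * Type 2 in terms of generators *)

Section Type2.
Variables (K : fieldType) (L : lieAlgType K).

(** The generators are representatives of the basis of L / L^2 that corresponds to the standard
    basis of row vectors. *)
Lemma has_type2_generating :
  has_type L 2 -> exists y : 'I_2 -> L, generating y.
Proof.
case=> -[f fl [g gK fK]]; pose y i := quot_repr (g (delta_mx 0 i)).
exists y => x; pose c := f (quot_pi _ x).
exists (c 0 0), (c 0 1), (x - (c 0 0 *: y 0 + c 0 1 *: y 1)); last first.
  by rewrite addrC subrK.
apply/quot_piP; apply: (can_inj gK); rewrite quot_piD !quot_piZ.
rewrite fl -[_ *: quot_pi _ (y 1)]addr0 fl !quot_reprK !fK.
have -> : f 0 = 0 by have := fl (-1) 0 0; rewrite scaler0 addr0 scaleN1r addNr.
rewrite -/c addr0 [LHS]row_sum_delta sum_ord2.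
by [].
Qed.

(** Spanning and independence modulo L^2 make [g] a linear bijection from row vectors onto L / L^2;
    [has_type] asks for its inverse. *)
Lemma generating_has_type2 (y : 'I_2 -> L) : generating y ->
  (forall a b, a *: y 0 + b *: y 1 \in lcs L 2 -> a = 0 /\ b = 0) ->
  has_type L 2.
Proof.
move=> yg yfree; pose Q := lieQuot (lcs L 2 : lieIdeal L).
pose g (c : 'rV[K]_2) : Q := quot_pi _ (c 0 0 *: y 0 + c 0 1 *: y 1).
have gl : linear g.
  move=> a u v; rewrite /g -quot_piZ -quot_piD !mxE; congr (quot_pi _ _).
  by rewrite scalerDr !scalerA !scalerDl addrACA.
have gI : injective g.
  move=> u v /quot_piP; rewrite opprD addrACA -!scalerBl => /yfree[].
  move=> /eqP; rewrite subr_eq0 => /eqP uv0 /eqP; rewrite subr_eq0 => /eqP uv1.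
  by apply/rowP => i; have [->|->] := ord2P i.
have gS u : exists c, g c = u.
  have [a [b [m m2 xE]]] := yg (quot_repr u).
  exists (\row_i if i == 0 then a else b); rewrite /g !mxE /= -[RHS]quot_reprK.
  by apply/quot_piP; rewrite xE opprD addrA subrr add0r rpredN.
have /choice[f fK] := gS; have gK : cancel g f by move=> c; apply: gI.
split; exists f; last by exists g.
by move=> a u v; apply: gI; rewrite gl !fK.
Qed.

End Type2.

(** * Invariant forms along the lower central series *)

Section Form.
Variables (K : fieldType) (L : lieAlgType K) (B : L -> L -> K).
Implicit Types (x m : L) (y : 'I_2 -> L).

(** A predicate on plain functions instead of [invForm], because [free_nil_lift_form] applies it to
    the difference of two forms. Linearity on the right follows by symmetry. *)
Definition inv_sym_bilinear :=
  [/\ forall a x z w, B (a *: x + z) w = a * B x w + B z w,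
      forall x z, B x z = B z x
    & forall x z w, B (lbr x z) w = B x (lbr z w)].

Hypothesis BP : inv_sym_bilinear.

Definition orthogonal_lcs i j :=
  forall x z, x \in lcs L i -> z \in lcs L j -> B x z = 0.

Let BC x z : B x z = B z x. Proof. by case: BP. Qed.
Let Bbr x z w : B (lbr x z) w = B x (lbr z w). Proof. by case: BP. Qed.
Let BDl x z w : B (x + z) w = B x w + B z w.
Proof. by have [+ _ _] := BP => /(_ 1 x z w); rewrite scale1r mul1r. Qed.
Let B0l z : B 0 z = 0.
Proof. by apply: (addrI (B 0 z)); rewrite -BDl !addr0. Qed.
Let BZl a x z : B (a *: x) z = a * B x z.
Proof. by have [+ _ _] := BP => /(_ a x 0 z); rewrite addr0 B0l addr0. Qed.
Let BDr x z w : B w (x + z) = B w x + B w z.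
Proof. by rewrite !(BC w) BDl. Qed.
Let BZr a x z : B z (a *: x) = a * B z x.
Proof. by rewrite !(BC z) BZl. Qed.
Let B0r z : B z 0 = 0. Proof. by rewrite BC B0l. Qed.
Let BNl x z : B (- x) z = - B x z.
Proof. by rewrite -scaleN1r BZl mulN1r. Qed.
Let BNr x z : B z (- x) = - B z x.
Proof. by rewrite !(BC z) BNl. Qed.
Let B_lbrl x z : B (lbr x z) x = 0.
Proof. by rewrite lbrC BNl Bbr lbrxx B0r oppr0. Qed.
Let B_lbrr x z : B (lbr z x) x = 0.
Proof. by rewrite Bbr lbrxx B0r. Qed.

(** Invariance moves one bracket across the form: B(x, [p, q]) = - B([x, q], p). *)
Lemma orthogonal_lcs_shift i j :
  orthogonal_lcs i.+2 j.+1 -> orthogonal_lcs i.+1 j.+2.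
Proof.
move=> H x z xi; move: z; apply: (@lcs_ind _ _ j).
- exact: B0r.
- by move=> a u v Bu Bv; rewrite BDr BZr Bu Bv mulr0 addr0.
- move=> p q pj; rewrite lbrC BNr -Bbr H ?oppr0 //; exact: lcs_lbrS.
Qed.

(** Start from L^(t+1) = 0 against L and shift. The indices of the two terms are [i.+1] and [j.+1],
    so the bound says that they add up to at least t + 2. *)
Lemma orthogonal_lcs_nilpotent t i j : (forall x, x \in lcs L t.+1 -> x = 0) ->
  (t <= i + j)%N -> orthogonal_lcs i.+1 j.+1.
Proof.
move=> L0; elim: j i => [|j IH] i.
  by rewrite addn0 => ti x z /(lcs_vanish L0 (ti : t < i.+1)%N) ->; rewrite B0l.
by rewrite addnS -addSn => /IH; apply: orthogonal_lcs_shift.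
Qed.

Variable y : 'I_2 -> L.
Hypothesis yg : generating y.
Local Notation h3 := (gen3 y).
Local Notation h4 := (gen4 y).

(** Invariance turns B([x, z], z) into B(x, [z, z]) = 0. *)
Lemma form_gen3_gen i : B h3 (y i) = 0.
Proof.
by rewrite /gen3; have [->|->] := ord2P i; rewrite ?B_lbrl ?B_lbrr.
Qed.

(** Modulo L^4, which a shift makes orthogonal to L^2, L^3 consists of brackets of h3, and
    B([h3, q], h3) = 0. *)
Lemma orthogonal_lcs_2_3 : orthogonal_lcs 3 3 -> orthogonal_lcs 2 3.
Proof.
move=> H33.
have H24 : orthogonal_lcs 2 4 by apply: orthogonal_lcs_shift.
have H x : x \in lcs L 3 -> B h3 x = 0.
  move: x; apply: (@lcs_ind _ _ 1); first exact: B0r.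
    by move=> a u v Bu Bv; rewrite BDr BZr Bu Bv mulr0 addr0.
  move=> p q /(lcs2_gen yg)[c [m m3 ->]]; rewrite lbrDl lbrZl BDr BZr.
  rewrite (BC _ (lbr h3 q)) B_lbrl mulr0 add0r; apply: H24; first exact: mem_gen3.
  exact: lcs_lbrS.
by move=> x z /(lcs2_gen yg)[c [m m3 ->]] z3; rewrite BDl BZl H // H33 // mulr0 addr0.
Qed.

Lemma orthogonal_lcs_2_2 :
  orthogonal_lcs 2 3 -> B h3 h3 = 0 -> orthogonal_lcs 2 2.
Proof.
move=> H23 H x z x2 /(lcs2_gen yg)[c [m m3 ->]]; rewrite BDr BZr (H23 x m) //.
rewrite addr0 BC; have [d [n n3 ->]] := lcs2_gen yg x2.
by rewrite BDr BZr H (H23 _ n) ?mem_gen3 // mulr0 addr0 mulr0.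
Qed.

(** A shift makes L orthogonal to L^3, so only h3 against the generators remains, and
    [form_gen3_gen] deals with it. *)
Lemma orthogonal_lcs_1_2 : orthogonal_lcs 2 2 -> orthogonal_lcs 1 2.
Proof.
move=> H22; have H13 : orthogonal_lcs 1 3 by apply: orthogonal_lcs_shift.
move=> x z _ /(lcs2_gen yg)[c [m m3 ->]]; rewrite BDr BZr (H13 x m) // addr0 BC.
have [a [b [n n2 ->]]] := yg x.
rewrite !BDr !BZr !form_gen3_gen H22 ?mem_gen3 // !mulr0 !addr0.
by rewrite mulr0.
Qed.

Lemma orthogonal_lcs_1_1 : orthogonal_lcs 1 2 ->
  (forall i j, B (y i) (y j) = 0) -> forall x z, B x z = 0.
Proof.
move=> H12 H x z; have [a [b [n n2 ->]]] := yg z; rewrite BDr (H12 x n) // addr0.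
rewrite BC; have [c [d [m m2 ->]]] := yg x; rewrite BDr (H12 _ m) // addr0.
by rewrite !BDl !BDr !BZl !BZr !H !mulr0 !addr0.
Qed.

Lemma orthogonal_lcs_3_3 : orthogonal_lcs 3 4 ->
  (forall i j, B (h4 i) (h4 j) = 0) -> orthogonal_lcs 3 3.
Proof.
move=> H34 H x z x3 /(lcs3_gen yg)[a [b [m m4 ->]]]; rewrite BDr (H34 x m) // addr0.
have [c [d [n n4 ->]]] := lcs3_gen yg x3; rewrite BC BDr (H34 _ n) ?addr0.
- by rewrite !BDl !BDr !BZl !BZr !H !mulr0 !addr0.
- by rewrite rpredD // lcsZ_mem // mem_gen4.
- by [].
Qed.

(** The three Gram matrices determine the form: orthogonality climbs from (L^3, L^4), where t <= 5
    gives it, up to (L, L), each Gram matrix opening one layer. *)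
Lemma form_eq0 t : (t <= 5)%N -> (forall x, x \in lcs L t.+1 -> x = 0) ->
    (forall i j, B (y i) (y j) = 0) -> B h3 h3 = 0 ->
    (forall i j, B (h4 i) (h4 j) = 0) ->
  forall x z, B x z = 0.
Proof.
move=> t5 L0 H1 H3 H4; apply: orthogonal_lcs_1_1 => //; apply: orthogonal_lcs_1_2.
apply: orthogonal_lcs_2_2 => //; apply: orthogonal_lcs_2_3.
by apply: orthogonal_lcs_3_3 => //; apply: (orthogonal_lcs_nilpotent L0).
Qed.

End Form.

Lemma form_inv_sym_bilinear (K : fieldType) (L : lieAlgType K) (B : invForm L) :
  inv_sym_bilinear B.
Proof.
split=> [a x z w|x z|x z w]; first by rewrite formDl formZl.
  exact: inv_sym.
exact: inv_lbr.
Qed.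

(** * Numerical invariants of a pair of generators, and dual pairs *)

Section MetricLie.
Variables (K : fieldType) (M : metricLie K) (t : nat).
Hypothesis M0 : forall x, x \in lcs M t.+1 -> x = 0.
Implicit Types (x : M) (y z n : 'I_2 -> M).
Local Notation B := (ml_form M).

Let BP : inv_sym_bilinear B. Proof. exact: form_inv_sym_bilinear. Qed.

Let B0r x : B x 0 = 0. Proof. by rewrite inv_sym form0l. Qed.
Let BNr x w : B x (- w) = - B x w.
Proof. by rewrite inv_sym formNl inv_sym. Qed.

Definition form_gen3 y := B (gen3 y) (gen3 y).
Definition gram4 y : 'M[K]_2 := \matrix_(i, j) B (gen4 y i) (gen4 y j).

Lemma gram4_sym y : (gram4 y)^T = gram4 y.
Proof. by apply/matrixP => i j; rewrite !mxE inv_sym. Qed.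

(** As M^2 is orthogonal to M^t, pairing with [z] reads off coordinates modulo M^2, see
    [dual_pairE]. *)
Definition dual_pair y z :=
  (forall i, z i \in lcs M t) /\ (forall i j, B (y i) (z j) = (i == j)%:R).

Lemma quadratic_orthogonal i : quadratic M -> orthogonal_lcs B 1 i ->
  forall x, x \in lcs M i -> x = 0.
Proof. by move=> Mq H x xi; apply: Mq => z; rewrite inv_sym; apply: H. Qed.

Lemma lcs2_orthogonal x m :
  (0 < t)%N -> m \in lcs M 2 -> x \in lcs M t -> B m x = 0.
Proof.
case: t M0 => // s M0' _; apply: (orthogonal_lcs_nilpotent BP M0').
by rewrite add1n.
Qed.

Lemma dual_pairE y z a b m : (0 < t)%N -> dual_pair y z -> m \in lcs M 2 ->
  B (a *: y 0 + b *: y 1 + m) (z 0) = a /\ B (a *: y 0 + b *: y 1 + m) (z 1) = b.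
Proof.
move=> t0 [zt yz] m2.
by rewrite !formDl !formZl !yz !(lcs2_orthogonal t0 m2) //= !mulr0 !mulr1 !addr0 add0r.
Qed.

(** A combination of the generators that lies in M^2 is orthogonal to [z], hence zero in both
    coordinates; and M^t contains [z 0], which pairs to 1 with [y 0]. *)
Lemma dual_pair_nilp_quadratic y z : (0 < t)%N -> quadratic M -> generating y ->
  dual_pair y z -> nilp_quadratic 2 t M.
Proof.
move=> t0 Mq yg yz; split=> //.
  apply: (generating_has_type2 yg) => a b ab2.
  have [E0 E1] := dual_pairE a b t0 yz (rpred0 (lcs M 2 : lieIdeal M)).
  have [zt _] := yz; rewrite addr0 in E0 E1.
  by split; [rewrite -E0|rewrite -E1]; apply: lcs2_orthogonal.
split=> //; exists (z 0); first by case: yz.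
apply/eqP => z0; have [_ /(_ 0 0)/eqP] := yz.
by rewrite z0 B0r eq_sym oner_eq0.
Qed.

(** * Ideals and indecomposability *)

Lemma gen3_ideal (I : lieIdeal M) y : generating y ->
  (exists2 k, k \in lcs M 3 & gen3 y + k \in I) ->
  forall x, x \in lcs M 2 -> x \in I.
Proof.
move=> yg [k k3 kI].
(* M^(i+2) is contained in I + M^(i+3): the multiples of h3 + k start the induction, and bracketing
   with arbitrary elements continues it. *)
have step i x : x \in lcs M i.+2 -> exists2 s, s \in I & x - s \in lcs M i.+3.
  elim: i x => [|i IH] x.
    move=> /(lcs2_gen yg)[c [m m3 ->]]; exists (c *: (gen3 y + k)).
      exact: ideal_scale.
    rewrite scalerDr opprD addrACA subrr add0r rpredB //; exact: lcsZ_mem.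
  move: x; apply: (@lcs_ind _ _ i.+1).
  - by exists 0; rewrite ?subr0 rpred0.
  - move=> a u v [s sI us] [s' s'I vs]; exists (a *: s + s').
      by rewrite rpredD //; apply: ideal_scale.
    rewrite opprD addrACA -scalerBr; exact: rpredD (lcsZ_mem _ us) vs.
  - move=> p q /IH[s sI ps]; exists (lbr s q); first exact: ideal_lbrl.
    rewrite -lbrNl -lbrDl; exact: lcs_lbrS.
have down i x : x \in lcs M 2 -> exists2 s, s \in I & x - s \in lcs M i.+2.
  move=> x2; elim: i => [|i [s sI /step[s' s'I xs]]].
    by exists 0; rewrite ?subr0 ?rpred0.
  by exists (s + s'); [rewrite rpredD|rewrite opprD addrA].
move=> x /(down t)[s sI xs]; have /M0/eqP : x - s \in lcs M t.+1.
  by apply: lcs_leq xs.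
by rewrite subr_eq0 => /eqP ->.
Qed.

(** Replace the element by a nonzero bracket of it as long as there is one; it stays in [I] and
    sinks in the series. In the generalization, [k] bounds the number of brackets left. *)
Lemma ideal_central (I : lieIdeal M) x : x \in I -> x != 0 ->
  exists2 z, z \in I & z != 0 /\ forall w, lbr z w = 0.
Proof.
suff H k i x' : (t <= i + k)%N -> x' \in I -> x' != 0 -> x' \in lcs M i.+1 ->
    exists2 z, z \in I & z != 0 /\ forall w, lbr z w = 0.
  by move=> xI x0; apply: (H t 0%N x).
elim: k i x' => [|k IH] i x'.
  rewrite addn0 => ti xI x0 xi; case/eqP: x0; apply: M0.
  exact: lcs_leq xi.
move=> tik xI x0 xi.
have [[w xw]|H] := pselect (exists w, lbr x' w <> 0); last first.
  by exists x' => //; split=> // w; apply: contrapT => xw; apply: H; exists w.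
apply: (IH i.+1 (lbr x' w)); first by rewrite addSnnS.
- exact: ideal_lbrl.
- exact/eqP.
- exact: lcs_lbrS.
Qed.

(* A central z in I is orthogonal to M^2, so I is not contained in M^2; hence I
   contains h3 modulo M^3 and so M^2.  If u in I is not in M^2, then M^t contains
   w <> 0 orthogonal to K u + M^2; as w is in I, I is larger than K u + M^2. *)
Lemma dual_pair_indecomposable y z : (1 < t)%N -> generating y ->
  dual_pair y z -> indecomposable M.
Proof.
move=> t1 yg yz [I [[x xI x0] [x' x'I] Inondeg]].
have t0 : (0 < t)%N by apply: ltnW.
have yzE a b m := dual_pairE a b t0 yz (m := m).
have [c cI [c0 cC]] := ideal_central xI x0.
have c2 m : m \in lcs M 2 -> B c m = 0.
  move: m; apply: (@lcs_ind _ _ 0) => [|a u v cu cv|p q _]; first exact: B0r.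
    by rewrite formDr formZr cu cv mulr0 addr0.
  by rewrite -inv_lbr cC form0l.
have [u uI cu] : exists2 u, u \in I & B c u <> 0.
  apply: contrapT => H; move/eqP: c0; apply; apply: Inondeg => // u uI.
  by apply: contrapT => cu; apply: H; exists u.
have [a [b [m m2 uE]]] := yg u.
have ab0 : (a != 0) || (b != 0).
  rewrite -negb_and; apply/negP => /andP[/eqP a0 /eqP b0]; apply: cu.
  by rewrite uE a0 b0 !scale0r !add0r c2.
have I2 : forall v, v \in lcs M 2 -> v \in I.
  apply: (gen3_ideal yg).
  have H d w : d != 0 -> (exists2 k, k \in lcs M 3 & lbr u w = d *: gen3 y + k) ->
      exists2 k, k \in lcs M 3 & gen3 y + k \in I.
    move=> d0 [k k3 uw]; exists (d^-1 *: k); first exact: lcsZ_mem.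
    rewrite -[gen3 y]scale1r -(mulVf d0) -scalerA -scalerDr -uw.
    by apply: ideal_scale; apply: ideal_lbrl.
  rewrite uE in H; case/orP: ab0 => d0.
    apply: (H (- a) (0 *: y 0 + 1 *: y 1 + 0)); first by rewrite oppr_eq0.
    have [|k k3 ->] := lbr_comb_lcs y a b 0 1 m2 (n := 0); first exact: rpred0.
    by exists k => //; rewrite mulr0 mulr1 sub0r.
  apply: (H b (1 *: y 0 + 0 *: y 1 + 0)) => //.
  have [|k k3 ->] := lbr_comb_lcs y a b 1 0 m2 (n := 0); first exact: rpred0.
  by exists k => //; rewrite mulr0 mulr1 subr0.
pose w := b *: z 0 - a *: z 1.
have wt : w \in lcs M t.
  by have [zt _] := yz; rewrite rpredB // lcsZ_mem.
have wE c' d' m' : m' \in lcs M 2 ->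
    B w (c' *: y 0 + d' *: y 1 + m') = b * c' - a * d'.
  move=> m'2; have [E0 E1] := yzE c' d' m' m'2.
  by rewrite inv_sym formBr !formZr E0 E1.
have w0 : w <> 0.
  move=> w0; case/orP: ab0 => /eqP; apply.
    apply/eqP; rewrite -oppr_eq0; apply/eqP.
    have := wE 0 1 0 (rpred0 (lcs M 2 : lieIdeal M)).
    by rewrite w0 form0l mulr0 mulr1 sub0r.
  have := wE 1 0 0 (rpred0 (lcs M 2 : lieIdeal M)).
  by rewrite w0 form0l mulr0 mulr1 subr0.
have wI : w \in I by apply: I2; apply: lcs_leq wt.
have [v vI wv] : exists2 v, v \in I & B w v <> 0.
  apply: contrapT => H; apply: w0; apply: Inondeg => // v vI.
  by apply: contrapT => wv; apply: H; exists v.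
have [c' [d' [m' m'2 vE]]] := yg v.
rewrite vE wE // in wv.
have uI' : a *: y 0 + b *: y 1 \in I by rewrite -(addrK m (_ + _)) -uE rpredB // I2.
have vI' : c' *: y 0 + d' *: y 1 \in I by rewrite -(addrK m' (_ + _)) -vE rpredB // I2.
have yI e f : e *: y 0 + f *: y 1 \in I.
  set D := b * c' - a * d' in wv.
  (* Cramer's rule for the coordinate vectors (a, b) and (c', d'); [D] is the value of B w v, which
     is nonzero. *)
  have -> : e *: y 0 + f *: y 1 =
      ((f * c' - e * d') / D) *: (a *: y 0 + b *: y 1)
      + ((e * b - f * a) / D) *: (c' *: y 0 + d' *: y 1).
    rewrite !scalerDr !scalerA addrACA -!scalerDl.
    by congr (_ *: _ + _ *: _); rewrite /D; field; apply/eqP.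
  by rewrite rpredD //; apply: ideal_scale.
move/negP: x'I; apply; have [e [f [n n2 ->]]] := yg x'.
by rewrite rpredD // I2.
Qed.

(** * Existence and use of dual pairs *)

Lemma form_lbr_gen w y :
  [/\ B (y 0) (lbr w (y 0)) = 0, B (y 0) (lbr w (y 1)) = B w (gen3 y),
      B (y 1) (lbr w (y 0)) = - B w (gen3 y) & B (y 1) (lbr w (y 1)) = 0].
Proof.
by split; rewrite inv_sym inv_lbr ?lbrxx ?B0r //; rewrite lbrC BNr.
Qed.

(** With w in M^(t-1), the brackets [w, y1] and - [w, y0] lie in M^t, and by [form_lbr_gen] they are
    dual to [y] up to the factor B(w, h3). *)
Lemma dual_pair_exists s y w : t = s.+2 -> w \in lcs M s.+1 ->
  B w (gen3 y) != 0 -> exists z, dual_pair y z.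
Proof.
move=> ts ws w0; set c := B w _ in w0.
exists (fun i => if i == 0 then c^-1 *: lbr w (y 1) else - c^-1 *: lbr w (y 0)).
split=> [i|i j].
  by case: ifP => _; apply: lcsZ_mem; rewrite ts; apply: lcs_lbrS.
have [E00 E01 E10 E11] := form_lbr_gen w y.
have [->|->] := ord2P i; have [->|->] := ord2P j;
  rewrite /= formZr ?E00 ?E01 ?E10 ?E11.
- by rewrite mulVf.
- by rewrite mulr0.
- by rewrite mulr0.
- by rewrite mulrNN mulVf.
Qed.

Lemma dual_pair_form_gen3 y :
  t = 3 -> form_gen3 y != 0 -> exists z, dual_pair y z.
Proof. by move=> t3; apply: (dual_pair_exists t3 (mem_gen3 y)). Qed.

Lemma dual_pair_gram4 y : t = 5 -> gram4 y != 0 -> exists z, dual_pair y z.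
Proof.
move=> t5 /matrix0Pn[i [j Gij]].
(* By invariance B([gen4 y i, y j], h3) is minus the chosen nonzero Gram entry. *)
apply: (dual_pair_exists (w := lbr (gen4 y i) (y j)) t5).
  exact: lcs_lbrS (mem_gen4 y i).
by rewrite inv_lbr lbrC BNr oppr_eq0; move: Gij; rewrite mxE.
Qed.

(** Subtract from each y_i half of the sum of the B(y_i, y_k) z_k. The two cross terms cancel B(y_i,
    y_j), and M^t is orthogonal to itself because t > 1. *)
Lemma dual_pair_isotropic y z : (1 < t)%N -> 2%:R != 0 :> K -> dual_pair y z ->
  exists2 n, forall i, n i \in lcs M t &
    forall i j, B (y i + n i) (y j + n j) = 0.
Proof.
move=> t1 K2 [zt yz].
pose n i := - 2%:R^-1 *: (B (y i) (y 0) *: z 0 + B (y i) (y 1) *: z 1).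
have nt i : n i \in lcs M t by apply: lcsZ_mem; rewrite rpredD // lcsZ_mem.
exists n => // i j.
have H i' j' : B (y i') (n j') = - 2%:R^-1 * B (y i') (y j').
  rewrite formZr formDr !formZr !yz (inv_sym (y i')).
  by have [->|->] := ord2P i'; rewrite /= !mulr1 !mulr0 ?addr0 ?add0r.
rewrite formDl !formDr H (inv_sym (n i) (y j)) H (inv_sym (y j)).
rewrite (lcs2_orthogonal (ltnW t1) (lcs_leq t1 (nt i)) (nt j)) addr0.
by field.
Qed.

(** * Effect of a change of generators; the columns of [P] hold the new coordinates *)

Section ChangeOfGenerators.
Variables (y y' n : 'I_2 -> M) (P : 'M[K]_2).
Hypothesis n2 : forall i, n i \in lcs M 2.
Hypothesis y'E : forall i, y' i = P 0 i *: y 0 + P 1 i *: y 1 + n i.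

Lemma gen3_change : exists2 k, k \in lcs M 3 & gen3 y' = \det P *: gen3 y + k.
Proof.
rewrite det2 /gen3 !y'E; exact: lbr_comb_lcs.
Qed.

(** h3 is multiplied by det P, and the bracket with the new generator contributes a column of P. *)
Lemma gen4_change i : exists2 k, k \in lcs M 4 &
  gen4 y' i = (\det P * P 0 i) *: gen4 y 0 + (\det P * P 1 i) *: gen4 y 1 + k.
Proof.
have [k k3 E] := gen3_change; rewrite /gen4 E.
exists (lbr (\det P *: gen3 y) (n i) + lbr k (y' i)).
  rewrite rpredD //; last exact: lcs_lbrS.
  rewrite lbrZl; apply: lcsZ_mem; apply: (@lcs_lbr_add _ _ 1 1) => //.
  exact: mem_gen3.
rewrite lbrDl addrA; congr (_ + _); rewrite y'E lbrDr; congr (_ + _).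
by rewrite lbrDr !lbrZl !lbrZr !scalerA.
Qed.

Lemma form_gen3_change : (t <= 3)%N -> form_gen3 y' = \det P ^+ 2 * form_gen3 y.
Proof.
move=> t3; have [k k3 E] := gen3_change; rewrite /form_gen3 E.
have H23 : orthogonal_lcs B 2 3 by apply: (orthogonal_lcs_nilpotent BP M0).
have g2 : \det P *: gen3 y \in lcs M 2 by apply: lcsZ_mem; apply: mem_gen3.
rewrite formDr !formDl (inv_sym k (_ *: _)) !(H23 _ k) ?(lcs_leq _ k3) //.
by rewrite !addr0 formZl formZr mulrA.
Qed.

(** For t <= 5 the corrections in M^4 are orthogonal to M^3, so [gen4_change] gives the exact Gram
    matrix. *)
Lemma gram4_change : (t <= 5)%N ->
  gram4 y' = \det P ^+ 2 *: (P^T *m gram4 y *m P).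
Proof.
move=> t5; apply/matrixP => i j; rewrite mxE.
have H34 : orthogonal_lcs B 3 4 by apply: (orthogonal_lcs_nilpotent BP M0).
have [k k4 Ei] := gen4_change i; have [l l4 Ej] := gen4_change j; rewrite Ei Ej.
have g3 a b : a *: gen4 y 0 + b *: gen4 y 1 \in lcs M 3.
  by rewrite rpredD // lcsZ_mem // mem_gen4.
rewrite formDr (H34 _ l) ?addr0 //; last by rewrite rpredD // (lcs_leq _ k4).
rewrite formDl (inv_sym k) (H34 _ k) // addr0 !mxE.
rewrite sum_ord2 !mxE !sum_ord2 !mxE !formDl !formDr !formZl !formZr; ring.
Qed.

End ChangeOfGenerators.

Lemma gram4_add y y' n : (t <= 5)%N -> (forall i, n i \in lcs M 2) ->
  (forall i, y' i = y i + n i) -> gram4 y' = gram4 y.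
Proof.
move=> t5 n2 y'E; rewrite (@gram4_change y y' n 1%:M) //.
  by rewrite det1 expr1n scale1r trmx1 mul1mx mulmx1.
move=> i; rewrite y'E !mxE; congr (_ + _).
by have [->|->] := ord2P i; rewrite /= scale1r scale0r ?addr0 ?add0r.
Qed.

Lemma form_gen3_add y y' n : (t <= 3)%N -> (forall i, n i \in lcs M 2) ->
  (forall i, y' i = y i + n i) -> form_gen3 y' = form_gen3 y.
Proof.
move=> t5 n2 y'E; rewrite (@form_gen3_change y y' n 1%:M) //.
  by rewrite det1 expr1n mul1r.
move=> i; rewrite y'E !mxE; congr (_ + _).
by have [->|->] := ord2P i; rewrite /= scale1r scale0r ?addr0 ?add0r.
Qed.

(** The bracket [n1, n0] lies in M^6 = 0, and the rest of the change of h3 lies in M^4, which is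
    orthogonal to itself; so the change of B(h3, h3) is linear in [n]. *)
Lemma form_gen3_lcs3 y n : (t <= 5)%N -> (forall i, n i \in lcs M 3) ->
  form_gen3 (fun i => y i + n i) =
    form_gen3 y + (B (gen4 y 1) (n 0) - B (gen4 y 0) (n 1)) *+ 2.
Proof.
move=> t5 n3; rewrite /form_gen3.
have -> : gen3 (fun i => y i + n i) = gen3 y + (lbr (y 1) (n 0) - lbr (y 0) (n 1)).
  rewrite /gen3 lbrDl !lbrDr (@M0 (lbr (n 1) (n 0))); last first.
    by apply: (@lcs_leq _ _ _ 6) => //; apply: (@lcs_lbr_add _ _ 2 2).
  by rewrite addr0 (lbrC (n 1)) addrA.
set k := _ - _; have kE : k = lbr (y 1) (n 0) - lbr (y 0) (n 1) by [].
clearbody k; have k4 : k \in lcs M 4.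
  by rewrite kE rpredB // lbrC rpredN; apply: lcs_lbrS.
have H24 : orthogonal_lcs B 4 3 by apply: (orthogonal_lcs_nilpotent BP M0).
rewrite formDl !formDr (inv_sym k) (H24 k k k4) ?addr0; last exact: lcs_leq k4.
rewrite -addrA -mulr2n; congr (_ + _ *+ 2).
by rewrite kE formBr -!inv_lbr.
Qed.

Lemma form_gen3_normalize y : (t <= 5)%N -> 2%:R != 0 :> K -> gram4 y != 0 ->
  exists2 n, forall i, n i \in lcs M 3 &
    form_gen3 (fun i => y i + n i) = 0.
Proof.
move=> t5 K2 /matrix0Pn[i [j Gij]].
pose c := form_gen3 y / (2%:R * gram4 y i j).
(* Only the generator other than [y i] moves. The sign offsets the opposite signs of the two terms
   in [form_gen3_lcs3]. *)
exists (fun k => if k == i then 0 else (-1) ^+ i * c *: gen4 y j).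
  by move=> k; case: ifP => _; rewrite ?rpred0 // lcsZ_mem // mem_gen4.
rewrite form_gen3_lcs3 //; last first.
  by move=> k; case: ifP => _; rewrite ?rpred0 // lcsZ_mem // mem_gen4.
rewrite mxE in Gij; rewrite /c mxE; have [i0|i1] := ord2P i.
  rewrite i0 /= B0r formZr expr0 sub0r; rewrite i0 in Gij *; field.
  by rewrite Gij K2.
rewrite i1 /= B0r formZr expr1 subr0; rewrite i1 in Gij *; field.
by rewrite Gij K2.
Qed.

(** Otherwise M^2 is orthogonal to itself, then to M, and nondegeneracy kills M^2, which contains
    M^t. *)
Lemma form_gen3_neq0 y : (1 < t <= 3)%N -> quadratic M -> generating y ->
  (exists2 x, x \in lcs M t & x != 0) -> form_gen3 y != 0.
Proof.
move=> /andP[t1 t3] Mq yg [x xt x0]; apply/eqP => g0; move/eqP: x0; apply.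
apply: (quadratic_orthogonal Mq _ (lcs_leq t1 xt)).
apply: (orthogonal_lcs_1_2 BP yg); apply: (orthogonal_lcs_2_2 BP yg) => //.
exact: (orthogonal_lcs_nilpotent BP M0).
Qed.

(** Otherwise M^3 is orthogonal to itself, then to M^2; a shift makes M^4 orthogonal to M, and M^4
    contains M^t. *)
Lemma gram4_neq0 y : (3 < t <= 5)%N -> quadratic M -> generating y ->
  (exists2 x, x \in lcs M t & x != 0) -> gram4 y != 0.
Proof.
move=> /andP[t3 t5] Mq yg [x xt x0]; apply/eqP => g0; move/eqP: x0; apply.
apply: (quadratic_orthogonal Mq _ (lcs_leq t3 xt)).
have H33 : orthogonal_lcs B 3 3.
  apply: (orthogonal_lcs_3_3 BP yg).
    exact: (orthogonal_lcs_nilpotent BP M0).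
  by move=> i j; move/matrixP: g0 => /(_ i j); rewrite !mxE.
apply: orthogonal_lcs_shift => //; exact: (orthogonal_lcs_2_3 BP yg).
Qed.

(** For t = 2 the filtration makes M^2 orthogonal to itself, against [form_gen3_neq0]. *)
Lemma no_index2 y : t = 2 -> quadratic M -> generating y ->
  (exists2 x, x \in lcs M t & x != 0) -> False.
Proof.
move=> t2 Mq yg Mt; have /negP[] : form_gen3 y != 0.
  by apply: form_gen3_neq0 => //; rewrite t2.
apply/eqP; apply: (orthogonal_lcs_nilpotent BP M0 (i := 1) (j := 1))
  (mem_gen3 y) (mem_gen3 y).
by rewrite t2.
Qed.

(** For t = 4 it makes M^3 orthogonal to itself, against [gram4_neq0]. *)
Lemma no_index4 y : t = 4 -> quadratic M -> generating y ->
  (exists2 x, x \in lcs M t & x != 0) -> False.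
Proof.
move=> t4 Mq yg Mt; have /negP[] : gram4 y != 0.
  by apply: gram4_neq0 => //; rewrite t4.
apply/eqP/matrixP => i j; rewrite !mxE.
apply: (orthogonal_lcs_nilpotent BP M0 (i := 2) (j := 2))
  (mem_gen4 y i) (mem_gen4 y j).
by rewrite t4.
Qed.

End MetricLie.

(** * Isometries, and isometries induced by surjective form-preserving morphisms *)

Section Isometry.
Variable K : fieldType.
Implicit Types M N : metricLie K.

Lemma isometric_sym M N : isometric M N -> isometric N M.
Proof.
case=> f [fP [g gK fK] fB]; exists g; split.
- split=> [a x z|x z]; apply: (can_inj gK); rewrite ?(proj1 fP) ?(proj2 fP) !fK //.
- by exists f.
- by move=> x z; rewrite -fB !fK.
Qed.

Lemma isometric_trans M N O : isometric M N -> isometric N O -> isometric M O.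
Proof.
case=> f [fP fbij fB] [g [gP gbij gB]]; exists (g \o f); split.
- split=> [a x z|x z] /=; first by rewrite (proj1 fP) (proj1 gP).
  by rewrite (proj2 fP) (proj2 gP).
- exact: bij_comp.
- by move=> x z /=; rewrite gB fB.
Qed.

Variables (L : lieAlgType K) (F : invForm L) (M : metricLie K) (f : L -> M).
Hypotheses (Mq : quadratic M) (fP : lie_morphism f).
Hypothesis fS : forall x, exists u, f u = x.
Hypothesis fF : forall u v, ml_form M (f u) (f v) = F u v.

(** As [f] is onto and the form of M is nondegenerate, the kernel of [f] is the kernel of the
    pulled-back form. *)
Let f_ker u : f u = 0 <-> forall v, F u v = 0.
Proof.
split=> [u0 v|Fu]; first by rewrite -fF u0 form0l.
by apply: Mq => x; have [v <-] := fS x; rewrite fF.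
Qed.

Lemma nondegenerate_isometric :
  nondegenerate_form F -> isometric (MetricLie F) M.
Proof.
move=> Fq; exists f; split=> //; apply: injective_surjective_bij => // u v uv.
apply/eqP; rewrite -subr_eq0; apply/eqP/Fq/f_ker.
by rewrite (lie_morphismB fP) uv subrr.
Qed.

Lemma reduced_isometric : isometric (reduced F) M.
Proof.
have fI u : u \in (form_ker F : lieIdeal L) -> f u = 0.
  by move=> /form_kerP/f_ker.
have gP := quot_lift_morphism fP fI.
exists (quot_lift (I := form_ker F : lieIdeal L) f); split=> //.
- apply: injective_surjective_bij => [u v|x].
    rewrite -[u]quot_reprK -[v]quot_reprK !(quot_liftE fP fI) => uv.
    apply/quot_piP/form_kerP/f_ker.
    by rewrite (lie_morphismB fP) uv subrr.
  by have [u <-] := fS x; exists (quot_pi _ u); rewrite (quot_liftE fP fI).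
- move=> u v; rewrite -[u]quot_reprK -[v]quot_reprK !(quot_liftE fP fI) fF.
  exact: esym (bar_formE _ _ _).
Qed.

End Isometry.

(** * Free nilpotent algebras on two generators and their universal property *)

Section FreeNilpotent.
Variables (K : fieldType) (t : nat).

(** Structural induction on a term; a bracket lies in L^2 and needs no induction hypothesis. *)
Lemma generating_free : generating (@free_gen K 'I_2).
Proof.
move=> u; rewrite -[u]lreprK.
elim: (lrepr u) => [i||s [a [b [m m2 sE]]] r [c [d [n n2 rE]]]|s [a [b [m m2 sE]]]|e s [a [b [m m2 sE]]]|s _ r _].
- have [->|->] := ord2P i; [exists 1, 0, 0|exists 0, 1, 0]; rewrite ?rpred0 //;
    by rewrite scale1r scale0r ?add0r ?addr0.
- by exists 0, 0, 0; rewrite ?rpred0 // !scale0r !addr0.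
- exists (a + c), (b + d), (m + n); first by rewrite rpredD.
  by rewrite -lpiD sE rE !scalerDl addrACA; congr (_ + _); rewrite addrACA.
- exists (- a), (- b), (- m); first by rewrite rpredN.
  have -> : lpi (LOpp s) = - lpi s by rewrite -fl_oppE.
  by rewrite sE !opprD !scaleNr.
- exists (e * a), (e * b), (e *: m); first by rewrite lcsZ_mem.
  by rewrite -lpiZ sE !scalerDr !scalerA.
- exists 0, 0, (lpi (LBr s r)); last by rewrite !scale0r !add0r.
  by rewrite -lpiB; apply: lcs_lbrS.
Qed.

Lemma generating_free_nil : generating (@free_nil_gen K 2 t).
Proof.
apply: (generating_surj (f := quot_pi _)) generating_free.
  exact: lie_morphism_quot_pi.
exact: quot_pi_surj.
Qed.

Lemma quot_lcs_vanish (L : lieAlgType K) (I : lieIdeal L) i :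
  (forall x, x \in lcs L i -> x \in I) ->
  forall u, u \in lcs (lieQuot I) i -> u = 0.
Proof.
move=> LI u /(lcs_surj (lie_morphism_quot_pi I) (quot_pi_surj (I := I)))[x xi <-].
by rewrite -(quot_pi0 I); apply/quot_piP; rewrite subr0; apply: LI.
Qed.

Lemma lcs_free_nil x : x \in lcs (freeNil K 2 t) t.+1 -> x = 0.
Proof. exact: quot_lcs_vanish. Qed.

Lemma hall_gen (i : 'I_2) : free_nil_gen K t i = hall K t i.+1.
Proof. by have [->|->] := ord2P i; congr free_nil_gen; apply: val_inj. Qed.

Lemma hall_gen3 : gen3 (@free_nil_gen K 2 t) = hall K t 3.
Proof. by rewrite /gen3 !hall_gen. Qed.

Lemma hall_gen4 i : gen4 (@free_nil_gen K 2 t) i = hall K t (4 + i).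
Proof. by rewrite /gen4 hall_gen3 !hall_gen; have [->|->] := ord2P i. Qed.

Variables (L : lieAlgType K) (y : 'I_2 -> L).
Hypothesis L0 : forall x, x \in lcs L t.+1 -> x = 0.

Definition free_nil_lift : freeNil K 2 t -> L := quot_lift (free_lift y).

Let free_lift0 x : x \in lcs (freeLie K 'I_2) t.+1 -> free_lift y x = 0.
Proof. by move=> xt; apply: L0; apply: lcs_morphism (free_lift_morphism y) xt. Qed.

Lemma free_nil_lift_morphism : lie_morphism free_nil_lift.
Proof. exact: quot_lift_morphism (free_lift_morphism y) free_lift0. Qed.

Lemma free_nil_lift_gen i : free_nil_lift (free_nil_gen K t i) = y i.
Proof.
by rewrite /free_nil_lift (quot_liftE (free_lift_morphism y) free_lift0) free_lift_gen.
Qed.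

Lemma free_nil_lift_surj : generating y -> forall x, exists u, free_nil_lift u = x.
Proof.
move=> yg; apply: (generating_subalgebra yg L0)
  => [i|a _ _ [u <-] [v <-]|_ _ [u <-] [v <-]].
- by exists (free_nil_gen K t i); apply: free_nil_lift_gen.
- by exists (a *: u + v); rewrite (proj1 free_nil_lift_morphism).
- by exists (lbr u v); rewrite (proj2 free_nil_lift_morphism).
Qed.

End FreeNilpotent.

(** * Pulling the form back to the free nilpotent algebra *)

Section Pullback.
Variables (K : fieldType) (t : nat) (M : metricLie K) (y : 'I_2 -> M).
Variable F : invForm (freeNil K 2 t).
Local Notation B := (ml_form M).
Local Notation h := (@free_nil_gen K 2 t).
Hypotheses (t5 : (t <= 5)%N) (M0 : forall x, x \in lcs M t.+1 -> x = 0).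
Hypothesis yiso : forall i j, B (y i) (y j) = 0.
Hypothesis hiso : forall i j, F (h i) (h j) = 0.
Hypothesis F3 : F (gen3 h) (gen3 h) = form_gen3 y.
Hypothesis F4 : forall i j, F (gen4 h i) (gen4 h j) = gram4 y i j.

Lemma free_nil_lift_form u v :
  B (free_nil_lift y u) (free_nil_lift y v) = F u v.
Proof.
have fP := free_nil_lift_morphism y M0; set f := free_nil_lift y in fP *.
(* The difference of the pulled-back form and [F] is invariant with zero Gram matrices, so
   [form_eq0] kills it. *)
pose D u v := B (f u) (f v) - F u v.
have DP : inv_sym_bilinear D.
  split=> [a x z w|x z|x z w]; rewrite /D.
  - by rewrite (proj1 fP) !formDl !formZl; ring.
  - by rewrite inv_sym [F x z]inv_sym.
  - by rewrite !(proj2 fP) !inv_lbr.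
have fh i : f (h i) = y i by apply: free_nil_lift_gen.
have f3 : f (gen3 h) = gen3 y by rewrite /gen3 (proj2 fP) !fh.
have f4 i : f (gen4 h i) = gen4 y i by rewrite /gen4 (proj2 fP) f3 fh.
apply/eqP; rewrite -subr_eq0; apply/eqP; change (D u v = 0).
apply: (form_eq0 DP (@generating_free_nil K t) t5 (@lcs_free_nil K t)) => [i j||i j].
- by rewrite /D !fh yiso hiso subrr.
- by rewrite /D f3 F3 subrr.
- by rewrite /D !f4 F4 mxE subrr.
Qed.

End Pullback.

(** * Gram matrices of the model forms *)

Lemma form23_gen (K : fieldType) (g : K) (i j : 'I_2) :
  form23 g (free_nil_gen K 3 i) (free_nil_gen K 3 j) = 0.
Proof.
rewrite !hall_gen form23_hall ?ltn_ord //; last first.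
- by rewrite /= (leq_trans (ltn_ord _)).
- by rewrite /= (leq_trans (ltn_ord _)).
rewrite /sym_table !big_cons big_nil.
by have [->|->] := ord2P i; have [->|->] := ord2P j; rewrite /= !addr0.
Qed.

Lemma form_gen3_metric23 (K : fieldType) (g : K) :
  form_gen3 (M := metric23 g) (@free_nil_gen K 2 3) = g.
Proof.
rewrite /form_gen3 /= hall_gen3 form23_hall // /sym_table !big_cons big_nil /=.
by rewrite !add0r addr0.
Qed.

Lemma form25_gen (K : fieldType) (A : 'M[K]_2) (i j : 'I_2) :
  form25 A (free_nil_gen K 5 i) (free_nil_gen K 5 j) = 0.
Proof.
rewrite !hall_gen form25_hall ?ltn_ord //; last first.
- by rewrite /= (leq_trans (ltn_ord _)).
- by rewrite /= (leq_trans (ltn_ord _)).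
rewrite /sym_table !big_cons big_nil.
by have [->|->] := ord2P i; have [->|->] := ord2P j; rewrite /= !addr0.
Qed.

Lemma form25_gen3 (K : fieldType) (A : 'M[K]_2) :
  form25 A (gen3 (@free_nil_gen K 2 5)) (gen3 (@free_nil_gen K 2 5)) = 0.
Proof.
rewrite hall_gen3 form25_hall // /sym_table !big_cons big_nil /=.
by rewrite !addr0.
Qed.

Lemma form25_gen4 (K : fieldType) (A : 'M[K]_2) (i j : 'I_2) : A^T = A ->
  form25 A (gen4 (@free_nil_gen K 2 5) i) (gen4 (@free_nil_gen K 2 5) j) = A i j.
Proof.
move=> AT; rewrite !hall_gen4 form25_hall ?addSn //; last first.
- by rewrite !ltnS (leq_trans (ltnW (ltn_ord _))).
- by rewrite !ltnS (leq_trans (ltnW (ltn_ord _))).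
rewrite /sym_table !big_cons big_nil.
have A10 : A 1 0 = A 0 1 by rewrite -{1}AT mxE.
by have [->|->] := ord2P i; have [->|->] := ord2P j;
  rewrite /= ?A10 !addr0 ?add0r.
Qed.

(** An element of the kernel of the form loses its coordinates layer by layer: pair it with the dual
    pair, then with h3, then with the generators; M^4 = 0 leaves nothing. *)
Lemma form_gen3_quadratic (K : fieldType) (M : metricLie K) (y : 'I_2 -> M) :
  (forall x, x \in lcs M 4 -> x = 0) -> generating y -> form_gen3 y != 0 ->
  quadratic M.
Proof.
move=> M0 yg g0 x xM.
have BP := form_inv_sym_bilinear (ml_form M).
have H23 : orthogonal_lcs (ml_form M) 2 3 by apply: (orthogonal_lcs_nilpotent BP M0).
have [z yz] := dual_pair_form_gen3 (t := 3) (erefl _) g0.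
have [a [b [m m2 xE]]] := yg x.
have [Ea Eb] := dual_pairE M0 a b isT yz m2; rewrite -xE !xM in Ea Eb.
rewrite -Ea -Eb !scale0r !add0r in xE.
have [c [k k3 mE]] := lcs2_gen yg m2.
have := xM (gen3 y); rewrite xE mE formDl formZl (inv_sym k).
rewrite (H23 _ k) ?mem_gen3 // addr0 => /eqP.
rewrite mulf_eq0 (negPf g0) orbF => /eqP c0.
rewrite c0 scale0r add0r in mE.
have [d [e [l /M0 l0 kE]]] := lcs3_gen yg k3; rewrite l0 addr0 in kE.
have [E00 E01 E10 E11] := form_lbr_gen (gen3 y) y.
have := xM (y 0); have := xM (y 1); rewrite xE mE kE !(inv_sym _ (y _)).
rewrite !formDr !formZr E00 E01 E10 E11 !mulr0 addr0 add0r mulrN.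
move=> /eqP; rewrite oppr_eq0 mulf_eq0 (negPf g0) orbF => /eqP ->.
move=> /eqP; rewrite mulf_eq0 (negPf g0) orbF => /eqP ->.
by rewrite c0 !scale0r !addr0.
Qed.

Lemma generating_matrix (K : fieldType) (L : lieAlgType K) (y y' : 'I_2 -> L) :
  generating y -> exists P : 'M[K]_2, exists2 n, forall i, n i \in lcs L 2 &
    forall i, y' i = P 0 i *: y 0 + P 1 i *: y 1 + n i.
Proof.
move=> yg; have [a0 [b0 [m0 m02 E0]]] := yg (y' 0).
have [a1 [b1 [m1 m12 E1]]] := yg (y' 1).
exists (\matrix_(i, j) if i == 0 then if j == 0 then a0 else a1
                       else if j == 0 then b0 else b1).
exists (fun i => if i == 0 then m0 else m1) => i; first by case: ifP.
by rewrite !mxE; have [->|->] := ord2P i.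
Qed.

(** * The two families of models *)

Section Models.
Variable K : fieldType.

Section Metric23.
Variable g : K.
Hypothesis g0 : g != 0.
Local Notation M := (metric23 g).
Local Notation h := (@free_nil_gen K 2 3 : 'I_2 -> M).

Let M0 x : x \in lcs M 4 -> x = 0. Proof. exact: lcs_free_nil. Qed.
Let hg : generating h. Proof. exact: generating_free_nil. Qed.
Let h0 : form_gen3 h != 0. Proof. by rewrite form_gen3_metric23. Qed.

Lemma metric23_quadratic : quadratic M.
Proof. exact: form_gen3_quadratic M0 hg h0. Qed.

Lemma metric23_nilp_quadratic : nilp_quadratic 2 3 M.
Proof.
have [z hz] := dual_pair_form_gen3 (t := 3) (erefl _) h0.
exact: (dual_pair_nilp_quadratic M0 _ metric23_quadratic hg hz).
Qed.

Lemma metric23_indecomposable : indecomposable M.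
Proof.
have [z hz] := dual_pair_form_gen3 (t := 3) (erefl _) h0.
exact: (dual_pair_indecomposable M0 _ hg hz).
Qed.

End Metric23.

Section Metric25.
Variable A : 'M[K]_2.
Hypotheses (AT : A^T = A) (A0 : A != 0).
Local Notation M := (metric25 A).

Definition metric25_gen (i : 'I_2) : M :=
  quot_pi (form_ker (form25 A)) (free_nil_gen K 5 i).

Lemma metric25_generating : generating metric25_gen.
Proof.
apply: (generating_surj (f := quot_pi _)); first exact: lie_morphism_quot_pi.
  exact: quot_pi_surj.
exact: generating_free_nil.
Qed.

Lemma lcs_metric25 x : x \in lcs M 6 -> x = 0.
Proof. by apply: quot_lcs_vanish => u /lcs_free_nil ->; rewrite rpred0. Qed.

Lemma metric25_gram4 : gram4 metric25_gen = A.
Proof.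
apply/matrixP => i j; rewrite mxE -(form25_gen4 i j AT).
have E k : gen4 metric25_gen k =
    quot_pi (form_ker (form25 A)) (gen4 (free_nil_gen K 5) k).
  by rewrite (gen4_morphism _ _ (lie_morphism_quot_pi _)).
by rewrite !E; apply: bar_formE.
Qed.

Lemma metric25_quadratic : quadratic M.
Proof. exact: bar_form_nondegenerate. Qed.

Let h0 : gram4 metric25_gen != 0. Proof. by rewrite metric25_gram4. Qed.

Lemma metric25_nilp_quadratic : nilp_quadratic 2 5 M.
Proof.
have [z hz] := dual_pair_gram4 (t := 5) (erefl _) h0.
exact: (dual_pair_nilp_quadratic lcs_metric25 _ metric25_quadratic
  metric25_generating hz).
Qed.

Lemma metric25_indecomposable : indecomposable M.
Proof.
have [z hz] := dual_pair_gram4 (t := 5) (erefl _) h0.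
exact: (dual_pair_indecomposable lcs_metric25 _ metric25_generating hz).
Qed.

End Metric25.

(** * Isometry of an arbitrary algebra with its model *)

Section Classification.
Hypothesis K2 : 2%:R != 0 :> K.
Variable M : metricLie K.
Hypothesis Mq : quadratic M.
Variable y : 'I_2 -> M.
Hypothesis yg : generating y.

Lemma form_gen3_isometric :
  (forall x, x \in lcs M 4 -> x = 0) -> form_gen3 y != 0 ->
  isometric (metric23 (form_gen3 y)) M.
Proof.
move=> M0 g0.
have [z yz] := dual_pair_form_gen3 (t := 3) (erefl _) g0.
have [n n3 yiso] := dual_pair_isotropic M0 (isT : (1 < 3)%N) K2 yz.
have n2 i : n i \in lcs M 2 by apply: lcs_leq (n3 i).
pose y' i := y i + n i; have y'g : generating y' by apply: (generating_add yg n2).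
have y'3 : form_gen3 y' = form_gen3 y by apply: (form_gen3_add M0 _ n2).
apply: (nondegenerate_isometric Mq (free_nil_lift_morphism y' M0)
  (@free_nil_lift_surj _ _ _ _ M0 y'g)); last exact: metric23_quadratic.
apply: free_nil_lift_form => // [i j||i j].
- exact: form23_gen.
- by rewrite y'3; apply: form_gen3_metric23.
rewrite mxE.
(* For t = 3 both Gram matrices of (h4, h5) vanish, as the third term is orthogonal to itself. *)
have H (M' : metricLie K) :
    (forall x, x \in lcs M' 4 -> x = 0) -> orthogonal_lcs (ml_form M') 3 3.
  move=> M'0; apply: (orthogonal_lcs_nilpotent _ M'0) => //.
  exact: form_inv_sym_bilinear.
rewrite (H M M0) ?mem_gen4 //.
apply: (H (metric23 (form_gen3 y)) (@lcs_free_nil K 3)); exact: mem_gen4.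
Qed.

(** B(h3, h3) is normalized first, with elements of M^3, and the generators are made isotropic
    afterwards, with elements of M^5 that leave h3 alone. *)
Lemma gram4_isometric : (forall x, x \in lcs M 6 -> x = 0) -> gram4 y != 0 ->
  isometric (metric25 (gram4 y)) M.
Proof.
move=> M0 g0.
have [n n3 y'3] := form_gen3_normalize M0 (leqnn 5) K2 g0.
have n2 i : n i \in lcs M 2 by apply: lcs_leq (n3 i).
pose y' i := y i + n i; have y'g : generating y' by apply: (generating_add yg n2).
have y'4 : gram4 y' = gram4 y by apply: (gram4_add M0 _ n2).
have [z yz] : exists z, dual_pair 5 y' z by apply: dual_pair_gram4; rewrite ?y'4.
have [k k5 yiso] := dual_pair_isotropic M0 (isT : (1 < 5)%N) K2 yz.
have k2 i : k i \in lcs M 2 by apply: lcs_leq (k5 i).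
pose y'' i := y' i + k i.
have y''g : generating y'' by apply: (generating_add y'g k2).
have y''4 : gram4 y'' = gram4 y by rewrite -y'4; apply: (gram4_add M0 _ k2).
have y''3 : form_gen3 y'' = 0.
  (* [k i] is in M^5, hence central because M^6 = 0, and h3 itself does not change. *)
  have kl i w : lbr (k i) w = 0 by apply: M0; apply: lcs_lbrS.
  have kr i w : lbr w (k i) = 0 by rewrite lbrC kl oppr0.
  by rewrite -y'3 /form_gen3 /gen3 /y'' !lbrDl !lbrDr !kl !kr !addr0.
apply: (reduced_isometric Mq (free_nil_lift_morphism y'' M0)
  (@free_nil_lift_surj _ _ _ _ M0 y''g)).
apply: free_nil_lift_form => // [i j||i j].
- exact: form25_gen.
- by rewrite y''3; apply: form25_gen3.
- by rewrite y''4; apply: form25_gen4; apply: gram4_sym.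
Qed.

End Classification.

Hypothesis K2 : 2%:R != 0 :> K.

Lemma nilp_quadratic23 (M : metricLie K) : nilp_quadratic 2 3 M ->
  exists2 g : K, g != 0 & isometric M (metric23 g).
Proof.
move=> [Mq /has_type2_generating[y yg] [M0 Mt]]; exists (form_gen3 y).
  exact: (form_gen3_neq0 M0).
apply: isometric_sym; apply: form_gen3_isometric => //; exact: (form_gen3_neq0 M0).
Qed.

Lemma nilp_quadratic25 (M : metricLie K) : nilp_quadratic 2 5 M ->
  exists A : 'M[K]_2, [/\ A^T = A, A != 0 & isometric M (metric25 A)].
Proof.
move=> [Mq /has_type2_generating[y yg] [M0 Mt]]; exists (gram4 y).
have G0 : gram4 y != 0 by apply: (gram4_neq0 M0).
by split=> //; [apply: gram4_sym|apply: isometric_sym; apply: gram4_isometric].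
Qed.

Lemma no_index_2_4 (M : metricLie K) :
  ~ nilp_quadratic 2 2 M /\ ~ nilp_quadratic 2 4 M.
Proof.
split=> -[Mq /has_type2_generating[y yg] [M0 Mt]].
  exact: (no_index2 M0 _ Mq yg).
exact: (no_index4 M0 _ Mq yg).
Qed.

(** An isometry carries generators to generators, and by [form_gen3_change] the determinant of their
    matrix is the required square root. *)
Lemma isometric23 (g d : K) : g != 0 -> d != 0 ->
  (isometric (metric23 g) (metric23 d) <-> exists2 k : K, k != 0 & d / g = k ^+ 2).
Proof.
move=> g0 d0; have M0 (c : K) (x : metric23 c) : x \in lcs (metric23 c) 4 -> x = 0.
  exact: lcs_free_nil.
pose h c : 'I_2 -> metric23 c := free_nil_gen K 3.
have hg c : generating (h c) by apply: generating_free_nil.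
split=> [/isometric_sym[f [fP _ fB]]|[k k0 dg]].
  have [P [n n2 fE]] := generating_matrix (f \o h d) (hg g).
  have := form_gen3_change (M0 g) n2 fE (leqnn 3); rewrite form_gen3_metric23.
  have -> : form_gen3 (f \o h d) = d.
    rewrite -[RHS](form_gen3_metric23 d) /form_gen3 -[RHS]fB /gen3.
    by rewrite (proj2 fP).
  move=> dE; exists (\det P).
    by apply/eqP => P0; move/eqP: d0; rewrite dE P0 expr0n mul0r.
  by rewrite dE mulfK.
(* The diagonal matrix with entries k and 1 has determinant k. *)
pose P : 'M[K]_2 := \matrix_(i, j) if i == j then if i == 0 then k else 1 else 0.
pose y i : metric23 g := P 0 i *: h g 0 + P 1 i *: h g 1 + 0.
have y3 : form_gen3 y = d.
  rewrite (@form_gen3_change _ _ 3 (M0 g) (h g) y (fun=> 0) P) //.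
    rewrite form_gen3_metric23 det2 !mxE /= mul1r mul0r subr0 -dg divfK //.
  by move=> i; rewrite rpred0.
rewrite -[X in isometric _ (metric23 X)]y3; apply: isometric_sym.
apply: form_gen3_isometric => //.
- exact: metric23_quadratic.
- move=> x; have [a [b [m m2 ->]]] := hg g x; exists (a / k), b, m => //.
  by rewrite /y !mxE /= !scale0r !addr0 add0r scale1r scalerA divfK.
- exact: M0.
- by rewrite y3.
Qed.

(** The same argument with [gram4_change]; conversely, the generators with matrix [P] have Gram
    matrix B, and [gram4_isometric] applies to them. *)
Lemma isometric25 (A B : 'M[K]_2) : A^T = A -> A != 0 -> B^T = B -> B != 0 ->
  (isometric (metric25 A) (metric25 B) <->
   exists2 P : 'M[K]_2, P \in unitmx & B = (\det P) ^+ 2 *: (P^T *m A *m P)).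
Proof.
move=> AT A0 BT B0; split=> [/isometric_sym[f [fP _ fB]]|[P Pu BE]].
  have [P [n n2 fE]] := generating_matrix (f \o @metric25_gen B)
    (@metric25_generating A).
  have := gram4_change (@lcs_metric25 A) n2 fE (leqnn 5).
  rewrite metric25_gram4 //.
  have -> : gram4 (f \o @metric25_gen B) = B.
    rewrite -[RHS](metric25_gram4 BT); apply/matrixP => i j.
    by rewrite [LHS]mxE [RHS]mxE -fB !(gen4_morphism _ _ fP).
  move=> BE; exists P => //; rewrite unitmxE unitfE; apply/eqP => P0.
  by move/eqP: B0; rewrite BE P0 expr0n scale0r.
pose h := @metric25_gen A.
pose y i : metric25 A := P 0 i *: h 0 + P 1 i *: h 1 + 0.
have y4 : gram4 y = B.
  rewrite (@gram4_change _ _ 5 (@lcs_metric25 A) h y (fun=> 0) P) //.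
    by rewrite metric25_gram4.
  by move=> i; rewrite rpred0.
rewrite -[X in isometric _ (metric25 X)]y4; apply: isometric_sym.
apply: gram4_isometric => //.
- exact: metric25_quadratic.
(* The new pair generates: its coordinates are obtained from the old ones through the inverse of
   [P]. *)
- have PV i j : P i 0 * invmx P 0 j + P i 1 * invmx P 1 j = (i == j)%:R.
    by have /matrixP/(_ i j) := mulmxV Pu; rewrite !mxE sum_ord2.
  move=> x; have [a [b [m m2 ->]]] := @metric25_generating A x.
  exists (invmx P 0 0 * a + invmx P 0 1 * b), (invmx P 1 0 * a + invmx P 1 1 * b), m => //.
  congr (_ + m); rewrite /y !addr0 !scalerDr !scalerA addrACA -!scalerDl.
  congr (_ *: _ + _ *: _).
    transitivity ((0 == 0 :> 'I_2)%:R * a + (0 == 1 :> 'I_2)%:R * b : K).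
      by rewrite /= mul0r addr0 mul1r.
    by rewrite -!PV; ring.
  transitivity ((1 == 0 :> 'I_2)%:R * a + (1 == 1 :> 'I_2)%:R * b : K).
    by rewrite /= mul0r add0r mul1r.
  by rewrite -!PV; ring.
- exact: lcs_metric25.
- by rewrite y4.
Qed.

(** Scalars are absorbed in the matrix: det P times P gives a congruence, and conversely cP works
    when c^3 is the inverse of det P, since then (c^2 det P)^2 c^2 = (c^3 det P)^2 = 1. *)
Lemma congruent_det_sqr (A B : 'M[K]_2) : (forall a : K, exists d : K, d ^+ 3 = a) ->
  ((exists2 P : 'M[K]_2, P \in unitmx & B = (\det P) ^+ 2 *: (P^T *m A *m P)) <->
   congruent A B).
Proof.
move=> cube.
have E c (P : 'M[K]_2) : (c *: P)^T *m A *m (c *: P) = c ^+ 2 *: (P^T *m A *m P).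
  have -> : (c *: P)^T = c *: P^T by apply/matrixP => i j; rewrite !mxE.
  by rewrite -!scalemxAl -scalemxAr scalerA expr2.
split=> -[P Pu ->]; have Pd : \det P != 0 by rewrite -unitfE -unitmxE.
  exists (\det P *: P); last by rewrite E.
  by rewrite unitmxE detZ unitfE mulf_neq0 ?expf_neq0.
have [c cE] := cube (\det P)^-1; exists (c *: P).
  rewrite unitmxE detZ unitfE mulf_neq0 // expf_neq0 //.
  by apply/eqP => c0; move: Pd; rewrite -invr_eq0 -cE c0 expr0n eqxx.
rewrite E detZ scalerA; set X := _ *m _.
suff -> : (c ^+ 2 * \det P) ^+ 2 * c ^+ 2 = 1 by rewrite scale1r.
have -> : (c ^+ 2 * \det P) ^+ 2 * c ^+ 2 = (c ^+ 3 * \det P) ^+ 2 by ring.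
by rewrite cE mulVf // expr1n.
Qed.

(** * Isometry classes of index 3 and square classes *)

Lemma sq_cosetP (g d : K) : g != 0 ->
  sq_coset g d <-> d != 0 /\ exists2 k : K, k != 0 & d / g = k ^+ 2.
Proof.
move=> g0; split=> [[k k0 ->]|[_ [k k0 dg]]]; last first.
  by exists k => //; rewrite -dg mulrCA divff ?mulr1.
split; first by rewrite mulf_neq0 // expf_neq0.
by exists k => //; rewrite mulrAC divff ?mul1r.
Qed.

Lemma classes23_in_bijection :
  classes_in_bijection (fun M : metricLie K => nilp_quadratic 2 3 M)
    (@isometric K) (sq_cosets K).
Proof.
(* The set of all admissible parameters avoids choosing one; by [isometric23] it is the square class
   of any of them. *)
exists (fun M => [set b | b != 0 /\ isometric M (metric23 b)]%classic).
have cE (M : metricLie K) (g : K) : g != 0 -> isometric M (metric23 g) ->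
    [set b | b != 0 /\ isometric M (metric23 b)]%classic = sq_coset g.
  move=> g0 Mg; apply/seteqP; split=> b.
    move=> [b0 Mb]; apply/(sq_cosetP _ g0); split=> //; apply/isometric23 => //.
    exact: isometric_trans (isometric_sym Mg) Mb.
  move=> /(sq_cosetP _ g0)[b0 gb]; split=> //.
  by apply: isometric_trans Mg _; apply/isometric23.
have coset_refl (g : K) : g != 0 -> sq_coset g g.
  by move=> g0; exists 1; rewrite ?oner_eq0 // expr1n mulr1.
split=> [M /nilp_quadratic23[g g0 Mg]|M N /nilp_quadratic23[g g0 Mg]
    /nilp_quadratic23[d d0 Nd]|_ [g g0 <-]].
- by rewrite (cE M g) //; exists g.
- split=> [MN|]; rewrite (cE M g) // (cE N d) //.
    rewrite -(cE M g) // -(cE M d) //; exact: isometric_trans MN Nd.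
  move=> gd; have := coset_refl d d0; rewrite -gd => /(sq_cosetP _ g0)[_ gd'].
  apply: isometric_trans Mg _; apply: isometric_trans (isometric_sym Nd).
  exact/isometric23.
- exists (metric23 g); first exact: metric23_nilp_quadratic.
  rewrite (cE (metric23 g) g) //; apply/isometric23 => //.
  by exists 1; rewrite ?oner_eq0 // divff ?expr1n.
Qed.

End Models.

Theorem corollary5p3 (K : fieldType) (charK0 : [pchar K] =i pred0) :
  (forall M : metricLie K, ~ nilp_quadratic 2 2 M /\ ~ nilp_quadratic 2 4 M)
  /\
  ((forall g : K, g != 0 -> nilp_quadratic 2 3 (metric23 g)) /\
   (forall M : metricLie K, nilp_quadratic 2 3 M ->
      exists2 g : K, g != 0 & isometric M (metric23 g)) /\
   (forall g d : K, g != 0 -> d != 0 ->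
      (isometric (metric23 g) (metric23 d) <->
       exists2 k : K, k != 0 & d / g = k ^+ 2)))
  /\
  ((forall A : 'M[K]_2, A^T = A -> A != 0 ->
      nilp_quadratic 2 5 (metric25 A)) /\
   (forall M : metricLie K, nilp_quadratic 2 5 M ->
      exists A : 'M[K]_2, [/\ A^T = A, A != 0 & isometric M (metric25 A)]) /\
   (forall A B : 'M[K]_2, A^T = A -> A != 0 -> B^T = B -> B != 0 ->
      (isometric (metric25 A) (metric25 B) <->
       exists2 P : 'M[K]_2, P \in unitmx &
         B = (\det P) ^+ 2 *: (P^T *m A *m P))))
  /\
  ((forall g : K, g != 0 -> indecomposable (metric23 g)) /\
   (forall A : 'M[K]_2, A^T = A -> A != 0 -> indecomposable (metric25 A)))
  /\
  classes_in_bijection (fun M : metricLie K => nilp_quadratic 2 3 M)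
    (@isometric K) (sq_cosets K)
  /\
  ((forall a : K, exists d : K, d ^+ 3 = a) ->
   forall A B : 'M[K]_2, A^T = A -> A != 0 -> B^T = B -> B != 0 ->
     (isometric (metric25 A) (metric25 B) <-> congruent A B)).
Proof.
have K2 : 2%:R != 0 :> K by rewrite (proj1 (pcharf0P K) charK0).
split; first exact: no_index_2_4.
split.
  split; first exact: metric23_nilp_quadratic.
  split; [exact: nilp_quadratic23|exact: isometric23].
split.
  split; first exact: metric25_nilp_quadratic.
  split; [exact: nilp_quadratic25|exact: isometric25].
split.
  split; [exact: metric23_indecomposable|exact: metric25_indecomposable].
split; first exact: classes23_in_bijection.
move=> cube A B AT A0 BT B0.
by rewrite (isometric25 K2 AT A0 BT B0); apply: congruent_det_sqr.
Qed.
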